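(* Let $X$ be a multiplicity graph of total multiplicity $n$ with lift $X'$ and projection $\pi:V(X')\to V(X)$, and let $Z_1,\dots,Z_r$ be the connected components of $\overline{X'}$. For each $\simeq$-class $C$ of acyclic orientations of $\overline{X'}$, fix $\alpha\in C$, let $\alpha^{(t)}$ be the restriction of $\alpha$ to $Z_t$, let $\pi_t$ be the period of $\alpha^{(t)}$, and let $\delta_C=\gcd(\pi_1,\dots,\pi_r)$; choose a linear extension $\sigma_C:[n]\to V(X')$ of some orientation in $C$, and let $H_C$ be the connected component of $\mathsf{FS}_m(\mathsf{Cycle}_n,X)$ containing $\pi\circ\sigma_C$. Then $H_C,\varphi^*(H_C),\dots,(\varphi^* )^{\delta_C-1}(H_C)$ are pairwise distinct, isomorphic connected components of $\mathsf{FS}_m(\mathsf{Cycle}_n,X)$, and $$\mathsf{FS}_m(\mathsf{Cycle}_n,X)=\bigoplus_{C}\ \bigoplus_{k=0}^{\delta_C-1}(\varphi^* )^k(H_C),$$ the outer sum running over all $\simeq$-classes $C$.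
   Context: The lift $X'$ of a multiplicity graph $X$ (multiplicities $c_v$) is the simple graph on $\bigsqcup_v S_v$, $|S_v|=c_v$, each $S_v$ a clique and $u'\in S_u,v'\in S_v$ ($u\ne v$) adjacent iff $uv\in E(X)$; $\pi$ maps $S_v$ to $v$; $\overline{X'}$ is its complement. $\mathsf{Cycle}_n$ is the cycle on $[n]$; $\mathsf{FS}_m(\mathsf{Cycle}_n,X)$ has vertices the functions $f:[n]\to V(X)$ with $|f^{-1}(v)|=c_v$, with $f,g$ adjacent if $f=g\circ(a\ b)$ for an edge $ab$ of $\mathsf{Cycle}_n$ with $f(a)f(b)\in E(X)$. $\varphi_q:[q]\to[q]$ is $k\mapsto k+1$ for $k<q$, $q\mapsto1$; $\varphi=\varphi_n$, and $\varphi^*$ is the automorphism $f\mapsto f\circ\varphi$ of $\mathsf{FS}_m(\mathsf{Cycle}_n,X)$. For a graph $G$ on $q$ vertices and a bijection $\sigma:[q]\to V(G)$, $\alpha_G(\sigma)$ orients $uv$ as $u\to v$ iff $\sigma^{-1}(u)<\sigma^{-1}(v)$; linear extensions of an acyclic orientation $\beta$ of $G$ are the $\sigma$ with $\alpha_G(\sigma)=\beta$. For $G$ equal to $\overline{X'}$ or to a component $Z$ of it (with $q=|V(G)|$), the period of a bijection $\sigma:[q]\to V(G)$ is the least $t\ge1$ with $\pi\circ\sigma\circ\varphi_q^t=\pi\circ\sigma$, and the period of an acyclic orientation of $G$ is the least period of its linear extensions. $\mathfrak{S}_X$ is the group of permutations $\rho$ of $V(X')$ with $\rho(S_v)=S_v$;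 $\alpha\equiv\beta$ if some $\rho\in\mathfrak{S}_X$ satisfies $u\to_\alpha v\iff\rho(u)\to_\beta\rho(v)$. A flip at a source or sink reverses all edges at it; $\alpha\sim\beta$ if related by a sequence of flips. $\simeq$ is the equivalence relation on acyclic orientations of $\overline{X'}$ generated by $\sim$ and $\equiv$. *)

(* Defs.v *)
From HB Require Import structures.
From mathcomp Require Import all_boot all_order all_fingroup.

Set Implicit Arguments.
Unset Strict Implicit.
Unset Printing Implicit Defensive.

Record sgraph := SGraph {
  svertex :> finType;
  sedge : rel svertex;
  sedge_sym : symmetric sedge;
  sedge_irrefl : irreflexive sedge }.

Arguments sedge {s}.

Section Graphs.
Variable G : sgraph.

Definition compl_edge : rel G := [rel x y | (x != y) && ~~ sedge x y].

Fact compl_edge_sym : symmetric compl_edge.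
Proof. by move=> x y; rewrite /compl_edge /= eq_sym sedge_sym. Qed.

Fact compl_edge_irrefl : irreflexive compl_edge.
Proof. by move=> x; rewrite /compl_edge /= eqxx. Qed.

Definition compl : sgraph := SGraph compl_edge_sym compl_edge_irrefl.

Variable A : {set G}.

Definition induced_edge : rel {x : G | x \in A} :=
  [rel x y | sedge (val x) (val y)].

Fact induced_edge_sym : symmetric induced_edge.
Proof. by move=> x y; exact: sedge_sym. Qed.

Fact induced_edge_irrefl : irreflexive induced_edge.
Proof. by move=> x; exact: sedge_irrefl. Qed.

Definition induced : sgraph := SGraph induced_edge_sym induced_edge_irrefl.

End Graphs.

(* Connected components are handled through their vertex sets. *)
Definition component (G : sgraph) (x : G) : {set G} :=
  [set y | connect sedge x y].

Definition components (G : sgraph) : {set {set G}} :=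
  [set component x | x : G].

Definition graph_iso (G H : sgraph) : Prop :=
  exists2 f : G -> H, bijective f & {mono f : x y / sedge x y}.

(* G is the direct sum of its induced subgraphs on the vertex sets F i, for i *)
(* satisfying P: these sets are disjoint, they cover G, and no edge of G      *)
(* joins two of them.                                                         *)
Definition is_direct_sum (G : sgraph) (I : eqType) (P : pred I)
    (F : I -> {set G}) : Prop :=
  [/\ {in P &, forall i j, i != j -> [disjoint F i & F j]},
      forall x : G, exists2 i, P i & x \in F i
    & {in P, forall i (x y : G), sedge x y -> (x \in F i) = (y \in F i)}].

Section AcyclicOrientations.
Variable G : sgraph.

(* An orientation is given by its set of arcs (tail, head). *)
Definition is_orientation (o : {set G * G}) :=
  [forall u : G, forall v : G,
    (((u, v) \in o) ==> sedge u v)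
    && (sedge u v ==> ((u, v) \in o) (+) ((v, u) \in o))].

Definition is_acyclic (o : {set G * G}) :=
  [forall u : G, forall v : G,
    ((u, v) \in o) ==> ~~ connect [rel x y | (x, y) \in o] v u].

Record acyc := Acyc {
  arcs :> {set G * G};
  arcsP : is_orientation arcs && is_acyclic arcs }.

HB.instance Definition _ := [isSub for arcs].
HB.instance Definition _ := [Finite of acyc by <:].

Definition arc (a : acyc) : rel G := [rel u v | (u, v) \in arcs a].

Definition source (a : acyc) (x : G) := [forall y : G, ~~ arc a y x].
Definition sink (a : acyc) (x : G) := [forall y : G, ~~ arc a x y].

Definition flip : rel acyc :=
  [rel a b : acyc | [exists x : G, (source a x || sink a x) &&
    [forall u : G, forall v : G,
      arc b u v == (if (u == x) || (v == x) then arc a v u else arc a u v)]]].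

Definition flip_equiv : rel acyc := connect flip.

End AcyclicOrientations.

Arguments arc {G}.

Lemma acycP (G : sgraph) (a : acyc G) :
  [/\ forall u v, arc a u v -> sedge u v,
      forall u v, sedge u v -> arc a u v (+) arc a v u
    & forall u v, arc a u v -> ~~ connect (arc a) v u].
Proof.
have /andP[/forallP oa /forallP aa] := arcsP a.
split=> u v.
- by have /forallP/(_ v)/andP[/implyP h _] := oa u; exact: h.
- by have /forallP/(_ v)/andP[_ /implyP h] := oa u; exact: h.
- by have /forallP/(_ v)/implyP h := aa u; exact: h.
Qed.

Section Restriction.
Variables (G : sgraph) (a : acyc G) (A : {set G}).

Definition restrict_arcs : {set induced A * induced A} :=
  [set p | arc a (val p.1) (val p.2)].

Fact restrict_arcsP : is_orientation restrict_arcs && is_acyclic restrict_arcs.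
Proof.
have [aE aX aC] := acycP a.
apply/andP; split; apply/forallP=> u; apply/forallP=> v.
  rewrite !inE /=; apply/andP; split; apply/implyP; first exact: aE.
  exact: aX.
apply/implyP; rewrite inE /= => /aC; apply: contra => /connectP[p].
elim: p v => [|w p IHp] v /=; first by move=> _ ->; exact: connect0.
case/andP; rewrite inE /= => vw pth lst.
by apply: connect_trans (connect1 vw) _; exact: IHp.
Qed.

Definition restrict : acyc (induced A) := Acyc restrict_arcsP.

End Restriction.

(* A bijection 'I_q -> G, packed with its inverse. *)
Record labeling (q : nat) (G : sgraph) := Labeling {
  lab_pair : {ffun 'I_q -> G} * {ffun G -> 'I_q};
  lab_pairP : [forall i, lab_pair.2 (lab_pair.1 i) == i]
              && [forall x, lab_pair.1 (lab_pair.2 x) == x] }.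

HB.instance Definition _ (q : nat) (G : sgraph) := [isSub for @lab_pair q G].
HB.instance Definition _ (q : nat) (G : sgraph) :=
  [Finite of labeling q G by <:].

Definition lab (q : nat) (G : sgraph) (s : labeling q G) : 'I_q -> G :=
  (lab_pair s).1.
Definition lab_inv (q : nat) (G : sgraph) (s : labeling q G) : G -> 'I_q :=
  (lab_pair s).2.

Coercion lab : labeling >-> Funclass.

Section Labelings.
Variables (q : nat) (G : sgraph).

Lemma labK (s : labeling q G) : cancel (lab s) (lab_inv s).
Proof. by move=> i; apply/eqP; have /andP[/forallP/(_ i)] := lab_pairP s. Qed.

Lemma lab_invK (s : labeling q G) : cancel (lab_inv s) (lab s).
Proof. by move=> x; apply/eqP; have /andP[_ /forallP/(_ x)] := lab_pairP s. Qed.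

Definition label_arcs (s : labeling q G) : {set G * G} :=
  [set p | sedge p.1 p.2 && (lab_inv s p.1 < lab_inv s p.2)].

Fact label_arcsP (s : labeling q G) :
  is_orientation (label_arcs s) && is_acyclic (label_arcs s).
Proof.
apply/andP; split; apply/forallP=> u; apply/forallP=> v.
  rewrite !inE /= (sedge_sym v u).
  case euv: (sedge u v) => //=; rewrite implybT /=.
  case: (ltngtP (lab_inv s u) (lab_inv s v)) => // /val_inj/(can_inj (lab_invK s)).
  by move=> uv; rewrite uv sedge_irrefl in euv.
apply/implyP; rewrite inE /= => /andP[_ uv].
apply/negP=> /connectP[p].
suff h : path [rel x y | (x, y) \in label_arcs s] v p ->
    lab_inv s v <= lab_inv s (last v p).
  by move=> /h + up; rewrite -up leqNgt uv.
elim: p {uv} v => //= w p IHp v /andP[]; rewrite inE /= => /andP[_ vw] /IHp.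
by apply: leq_trans; exact: ltnW.
Qed.

Definition orientation_of (s : labeling q G) : acyc G := Acyc (label_arcsP s).

Definition linear_extension (a : acyc G) (s : labeling q G) :=
  orientation_of s == a.

End Labelings.

Lemma val_iter_ordS (q t : nat) (i : 'I_q) :
  iter t (@ordS q) i = (i + t) %% q :> nat.
Proof.
elim: t => [|t IHt] /=; first by rewrite addn0 modn_small.
by rewrite IHt -addn1 modnDml addn1 addnS.
Qed.

(* The points 1, ..., q are represented by 0, ..., q - 1, so that ordS is the *)
(* rotation sending each point to the next one and the last to the first.     *)
Section Periods.
Variables (G : sgraph) (P : eqType) (p : G -> P).

Definition periodic (q : nat) (s : labeling q G) (t : nat) :=
  (0 < t) && [forall i, p (s (iter t (@ordS q) i)) == p (s i)].

Fact ex_periodic (q : nat) (s : labeling q G) : exists t, periodic s t.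
Proof.
case: q s => [|q] s; first by exists 1; apply/andP; split=> //; apply/forallP; case.
exists q.+1; apply/andP; split=> //; apply/forallP=> i; apply/eqP.
by congr (p (s _)); apply: val_inj; rewrite [LHS]val_iter_ordS modnDr modn_small.
Qed.

Definition label_period (q : nat) (s : labeling q G) : nat :=
  ex_minn (ex_periodic s).

End Periods.

Lemma ex_linear_extension (G : sgraph) (a : acyc G) :
  exists s : labeling #|G| G, linear_extension a s.
Proof.
have [aE aX aC] := acycP a.
pose h (u : G) := #|[set w | connect (arc a) w u]|.
have h_arc u v : arc a u v -> h u < h v.
  move=> uv; apply: proper_card; apply/properP; split.
    apply/subsetP=> w; rewrite !inE => wu.
    exact: connect_trans wu (connect1 uv).
  by exists v; rewrite inE ?connect0 // aC.
pose l := sort (relpre h leq) (enum G).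
have l_all x : x \in l by rewrite mem_sort mem_enum.
have l_uniq : uniq l by rewrite sort_uniq enum_uniq.
have l_size : size l = #|G| by rewrite size_sort -cardE.
have l_sorted : sorted (relpre h leq) l.
  by apply: sort_sorted => x y; exact: leq_total.
have idx x : index x l < #|G| by rewrite -l_size index_mem.
pose g : {ffun G -> 'I_#|G|} := [ffun x => Ordinal (idx x)].
pose f : {ffun 'I_#|G| -> G} := [ffun i => nth (enum_val i) l i].
have fg : [forall i, (f, g).2 ((f, g).1 i) == i]
       && [forall x, (f, g).1 ((f, g).2 x) == x].
  apply/andP; split; apply/forallP=> x; apply/eqP=> /=; rewrite !ffunE.
    by apply: val_inj; rewrite /= index_uniq ?l_size.
  by rewrite /= nth_index.
pose s : labeling #|G| G := Labeling fg.
have lt_h u v : index u l < index v l -> h u <= h v.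
  move=> uv.
  have tr : transitive (relpre h leq) by move=> y x z; exact: leq_trans.
  have := sorted_leq_nth tr (fun x => leqnn (h x)) u l_sorted.
  move/(_ (index u l) (index v l)).
  by rewrite !inE !index_mem !l_all !nth_index //; apply=> //; exact: ltnW.
exists s; apply/eqP/val_inj/setP=> -[u v] /=.
rewrite inE /= /lab_inv /= !ffunE /=.
rewrite -[(u, v) \in arcs a]/(arc a u v).
case euv: (sedge u v) => /=; last first.
  by apply/esym/negP=> /aE; rewrite euv.
have := aX u v euv.
case: (ltngtP (index u l) (index v l)) => [ltuv|ltvu|equv].
- case auv: (arc a u v) => //= /h_arc.
  by rewrite ltnNge lt_h.
- case auv: (arc a u v) => //= _.
  by have := h_arc _ _ auv; rewrite ltnNge lt_h.
- have uv : u = v by rewrite -(nth_index u (l_all u)) equv nth_index.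
  by rewrite uv sedge_irrefl in euv.
Qed.

Section OrientationPeriod.
Variables (G : sgraph) (P : eqType) (p : G -> P) (a : acyc G).

Definition has_label_period (t : nat) :=
  [exists s : labeling #|G| G,
    linear_extension a s && (label_period p s == t)].

Fact ex_has_label_period : exists t, has_label_period t.
Proof.
have [s s_a] := ex_linear_extension a.
by exists (label_period p s); apply/existsP; exists s; rewrite s_a eqxx.
Qed.

Definition orientation_period : nat := ex_minn ex_has_label_period.

End OrientationPeriod.

Record mgraph := MGraph {
  base :> sgraph;
  mult : base -> nat }.

Arguments mult {m}.

Definition total_mult (X : mgraph) : nat := \sum_(v : X) mult v.

Section Lift.
Variable X : mgraph.

Definition lift_vertex : finType := {v : X & 'I_(mult v)}.

Definition lift_edge : rel lift_vertex :=
  [rel x y | if tag x == tag y then x != y else sedge (tag x) (tag y)].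

Fact lift_edge_sym : symmetric lift_edge.
Proof.
by move=> x y; rewrite /lift_edge /= (eq_sym (tag x)) (eq_sym x) sedge_sym.
Qed.

Fact lift_edge_irrefl : irreflexive lift_edge.
Proof. by move=> x; rewrite /lift_edge /= !eqxx. Qed.

Definition lift_graph : sgraph := SGraph lift_edge_sym lift_edge_irrefl.

Definition colift : sgraph := compl lift_graph.

Definition proj (x : colift) : X := tag x.

Definition fiber (v : X) : {set colift} := [set x | proj x == v].

Definition fiber_perms : {set {perm colift}} :=
  [set r : {perm colift} | [forall v, r @: fiber v == fiber v]].

Definition perm_equiv : rel (acyc colift) :=
  [rel a b : acyc colift | [exists r in fiber_perms,
    [forall u, forall v, arc a u v == arc b (r u) (r v)]]].

(* The generated equivalence relation: reflexive-transitive closure of the    *)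
(* symmetrized union.                                                         *)
Definition simeq : rel (acyc colift) :=
  connect [rel a b | [|| flip_equiv a b, flip_equiv b a,
                         perm_equiv a b | perm_equiv b a]].

Definition simeq_classes : {set {set acyc colift}} :=
  [set [set b | simeq a b] | a : acyc colift].

Definition delta (a : acyc colift) : nat :=
  \big[gcdn/0]_(Z in components colift)
    orientation_period (fun x : induced Z => proj (val x)) (restrict a Z).

End Lift.

Section Cycle.
Variable n : nat.

(* For n = 2 this is a single edge and for n = 1 a single vertex. *)
Definition cycle_edge : rel 'I_n :=
  [rel a b | (a != b) && ((b == ordS a) || (a == ordS b))].

Fact cycle_edge_sym : symmetric cycle_edge.
Proof. by move=> a b; rewrite /cycle_edge /= eq_sym orbC. Qed.

Fact cycle_edge_irrefl : irreflexive cycle_edge.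
Proof. by move=> a; rewrite /cycle_edge /= eqxx. Qed.

Definition Cycle : sgraph := SGraph cycle_edge_sym cycle_edge_irrefl.

End Cycle.

Section FriendsStrangers.
Variables (n : nat) (X : mgraph).

Definition is_FS_vertex (f : {ffun Cycle n -> X}) :=
  [forall v, #|f @^-1: [set v]| == mult v].

Definition FS_vertex : finType := {f : {ffun Cycle n -> X} | is_FS_vertex f}.

Definition FS_edge : rel FS_vertex :=
  [rel f g : FS_vertex | [exists a : Cycle n, exists b : Cycle n,
    [&& sedge a b, sedge (val f a) (val f b)
      & [forall i, val f i == val g (tperm a b i)]]]].

Fact FS_edge_sym : symmetric FS_edge.
Proof.
suff h f g : FS_edge f g -> FS_edge g f by move=> f g; apply/idP/idP; exact: h.
case/existsP=> a /existsP[b] /and3P[ab fab /forallP fg].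
apply/existsP; exists a; apply/existsP; exists b; rewrite ab /=.
have gf i : val g i = val f (tperm a b i) by rewrite (eqP (fg _)) tpermK.
rewrite !gf tpermL tpermR sedge_sym fab /=.
by apply/forallP=> i; rewrite gf.
Qed.

Fact FS_edge_irrefl : irreflexive FS_edge.
Proof.
move=> f; apply/negbTE/negP => /existsP[a] /existsP[b] /and3P[_ fab /forallP/(_ a)].
by rewrite tpermL => /eqP ab; rewrite ab sedge_irrefl in fab.
Qed.

Definition FS : sgraph := SGraph FS_edge_sym FS_edge_irrefl.

Fact rotate_subproof (f : FS) :
  is_FS_vertex [ffun i : Cycle n => val f (ordS i)].
Proof.
apply/forallP=> v; apply/eqP; rewrite -(eqP (forallP (valP f) v)).
rewrite -[RHS](on_card_preimset (onW_bij _ (ordS_bij n))).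
by apply: eq_card => i; rewrite !inE ffunE.
Qed.

Definition rotate (f : FS) : FS := Sub _ (rotate_subproof f).

Lemma rotate_bij : bijective rotate.
Proof.
apply: injF_bij => f g /(congr1 val) /= /ffunP fg; apply: val_inj.
by apply/ffunP=> i; have := fg (ord_pred i); rewrite !ffunE ord_predK.
Qed.

Lemma sedge_rotate : {mono rotate : f g / sedge f g}.
Proof.
move=> f g; change (FS_edge (rotate f) (rotate g) = FS_edge f g).
apply/existsP/existsP=> -[a /existsP[b /and3P[ab fab /forallP fg]]].
  exists (ordS a); apply/existsP; exists (ordS b).
  move: ab fab; rewrite /= /cycle_edge /= !(inj_eq (@ordS_inj n)) !ffunE.
  move=> -> -> /=; apply/forallP=> i; have := fg (ord_pred i).
  by rewrite /= !ffunE (inj_tperm _ _ _ (@ordS_inj n)) ord_predK.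
move: ab fab fg; rewrite -[a]ord_predK -[b]ord_predK.
move: (ord_pred a) (ord_pred b) => {}a {}b.
rewrite /= /cycle_edge /= !(inj_eq (@ordS_inj n)) => ab fab fg.
exists a; apply/existsP; exists b; rewrite !ffunE /= /cycle_edge /= ab fab /=.
apply/forallP=> i; have := fg (ordS i).
by rewrite !ffunE (inj_tperm _ _ _ (@ordS_inj n)).
Qed.

Fact card_fiber (v : X) : #|fiber v| = mult v.
Proof.
rewrite -[RHS]card_ord.
have inj : injective (fun i : 'I_(mult v) => Tagged (fun v => 'I_(mult v)) i).
  by move=> i j /eqP; rewrite eq_Tagged => /eqP.
rewrite -(card_imset _ inj); apply: eq_card => -[w i]; rewrite inE /proj /=.
apply/eqP/imsetP=> [wv | [j _ /(congr1 tag)] //].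
by case: _ / wv; exists i.
Qed.

Fact labeling_vertex_subproof (s : labeling n (colift X)) :
  is_FS_vertex [ffun i : Cycle n => proj (s i)].
Proof.
apply/forallP=> v; apply/eqP; rewrite -(card_fiber v).
rewrite -[RHS](on_card_preimset (onW_bij _ (Bijective (labK s) (lab_invK s)))).
by apply: eq_card => i; rewrite !inE ffunE.
Qed.

Definition labeling_vertex (s : labeling n (colift X)) : FS :=
  Sub _ (labeling_vertex_subproof s).

End FriendsStrangers.

(* Main.v *)
Require Import Defs.
From mathcomp Require Import all_boot all_order all_fingroup.
From mathcomp Require Import zify.

(* A vertex of FS(Cycle_n, X) is the projection of a labeling of the colift.   *)
(* Two labelings with the same orientation differ by adjacent swaps of tokens, *)
(* i.e. vertices of the colift, whose projections are equal or adjacent in X,  *)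
(* so their projections lie in one component of FS; flips are                  *)
(* rotations of suitable linear extensions, and fiber permutations do not      *)
(* change the vertex. So simeq classes correspond to components up to          *)
(* rotation, and it remains to show that the rotations fixing the component of *)
(* a vertex with orientation a are the multiples of delta a.                   *)
(* If a linear extension of a on a component Z of the colift has period p,     *)
(* place it in front of the rest: rotating by p and moving the p tokens back   *)
(* through tokens outside Z, which commute with them, restores the word.       *)
(* Conversely, view vertices as periodic infinite words. A path from f to its  *)
(* rotation by k identifies the occurrences of each letter v in f with those   *)
(* in f after skipping e(v) of them, preserving the interleaving of            *)
(* noncommuting letters, with \sum_v e(v) = -k modulo n. Comparing densities,  *)
(* e is proportional to the multiplicities on each Z. Such vectors are closed  *)
(* under differences, so Bezout yields one whose sum over Z is the gcd g of    *)
(* \sum_(v in Z) e(v), |Z| and the period of a on Z; repeating the first e(v)  *)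
(* tokens of each letter gives a linear extension on Z with period g. By       *)
(* minimality the period of a on Z equals g, and so divides the sum.           *)

Set Implicit Arguments.
Unset Strict Implicit.
Unset Printing Implicit Defensive.

(* Undoes the shadowing by path.arc. *)
Local Notation arc := Defs.arc.

(** Components up to rotation match the $\simeq$-classes by [connect_simeq] and [simeq_lv_rel], so
    everything reduces to [rotate_stabilizer]: the rotations that fix a component are the multiples
    of the delta of its class. Such multiples do fix it by [delta_rotate], which rests on
    [rotate_period_connect] for a single component of the colift. For the converse, what survives
    along a path is a [shifted] relation between infinite words; its skip vectors add up under
    composition ([shifted_trans], [shifted_connect]). Closing the path by a rotation gives a
    self-shift. By [period_on_dvd], its total over a component that contains whole fibers is
    divisible by the period there, thanks to [self_shift_gcd] and [ex_periodic_extension]; all other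
    components have period 1. Summing up gives [delta_dvd]. *)

(** * Labelings as words, and the orientations they induce *)

Section LabelingTheory.
Variables (q : nat) (G : sgraph).
Implicit Types s : labeling q G.

Lemma card_labeling s : #|G| = q.
Proof.
by rewrite -[RHS]card_ord; apply/esym/(bij_eq_card (Bijective (labK s) (lab_invK s))).
Qed.

Lemma lab_inj s : injective s.
Proof. exact: can_inj (labK s). Qed.

Lemma lab_inv_inj s : injective (lab_inv s).
Proof. exact: can_inj (lab_invK s). Qed.

Lemma labeling_of_cancel (f : 'I_q -> G) (g : G -> 'I_q) :
  cancel f g -> cancel g f ->
  exists2 s : labeling q G, lab s =1 f & lab_inv s =1 g.
Proof.
move=> fK gK.
have P : [forall i, (finfun f, finfun g).2 ((finfun f, finfun g).1 i) == i]
       && [forall x, (finfun f, finfun g).1 ((finfun f, finfun g).2 x) == x].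
  by apply/andP; split; apply/forallP=> x /=; rewrite !ffunE ?fK ?gK.
by exists (Labeling P) => x; rewrite /lab /lab_inv /= ffunE.
Qed.

Lemma ex_labeling (f : 'I_q -> G) : injective f -> #|G| = q ->
  exists s : labeling q G, lab s =1 f.
Proof.
move=> f_inj cG.
have [|g fK gK] := inj_card_bij f_inj; first by rewrite cG card_ord.
by have [s sf _] := labeling_of_cancel fK gK; exists s.
Qed.

Lemma ex_labeling_inv (g : G -> 'I_q) : injective g -> #|G| = q ->
  exists s : labeling q G, lab_inv s =1 g.
Proof.
move=> g_inj cG.
have [|f gK fK] := inj_card_bij g_inj; first by rewrite cG card_ord.
by have [s _ sg] := labeling_of_cancel fK gK; exists s.
Qed.

Lemma arc_orientation_of s x y :
  arc (orientation_of s) x y = sedge x y && (lab_inv s x < lab_inv s y).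
Proof. by rewrite /arc /= inE. Qed.

End LabelingTheory.

Lemma ex_labeling_seq (q : nat) (G : sgraph) (w : seq G) :
  uniq w -> (forall x, x \in w) -> #|G| = q ->
  exists2 s : labeling q G, forall x, lab_inv s x = index x w :> nat
    & forall (x0 : G) i, s i = nth x0 w i.
Proof.
move=> w_uniq w_all cG.
have w_size : size w = q by rewrite -cG -(card_uniqP w_uniq); apply: eq_card.
have idx x : index x w < q by rewrite -w_size index_mem.
have [|s sE] := @ex_labeling_inv q G (fun x => Ordinal (idx x)) _ cG.
  move=> x y [] xy; rewrite -(nth_index x (w_all x)) xy.
  by rewrite (set_nth_default y) ?index_mem // nth_index.
exists s => [x|x0 i]; first by rewrite sE.
have -> : i = index (s i) w :> nat by rewrite -[LHS]/(val i) -{1}(labK s i) sE.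
by rewrite nth_index.
Qed.

Lemma index_codom (q : nat) (G : sgraph) (s : labeling q G) x :
  index x (codom s) = lab_inv s x.
Proof.
by rewrite -{1}(lab_invK s x) index_map ?index_enum_ord //; exact: lab_inj.
Qed.

Lemma codom_uniq (q : nat) (G : sgraph) (s : labeling q G) : uniq (codom s).
Proof. by apply/injectiveP; exact: (@lab_inj _ _ s). Qed.

Lemma mem_codom_lab (q : nat) (G : sgraph) (s : labeling q G) x : x \in codom s.
Proof. by rewrite -(lab_invK s x) codom_f. Qed.

Lemma index_filter_lt (T : eqType) (P : pred T) (w : seq T) x y : P x -> P y ->
  (index x (filter P w) < index y (filter P w)) = (index x w < index y w).
Proof.
move=> Px Py; elim: w => //= z w IHw.
have [zx|nzx] := eqVneq z x; have [zy|nzy] := eqVneq z y.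
- by rewrite zx Px /= eqxx -zx zy eqxx.
- by rewrite zx Px /= eqxx -zx (negbTE nzy).
- by rewrite zy Py /= eqxx.
- by case: ifP => _ /=; rewrite ?(negbTE nzx) ?(negbTE nzy) ltnS.
Qed.

Lemma acyc_ext (G : sgraph) (a b : acyc G) : arc a =2 arc b -> a = b.
Proof. by move=> ab; apply/val_inj/setP=> -[x y]; exact: ab. Qed.

(** One implication suffices: exactly one of the two orders holds on each edge, so the hypothesis
    for the reversed edge gives the converse. *)
Lemma eq_orientation_of (q q' : nat) (G : sgraph)
    (s : labeling q G) (s' : labeling q' G) :
  (forall x y, sedge x y ->
    lab_inv s x < lab_inv s y -> lab_inv s' x < lab_inv s' y) ->
  orientation_of s = orientation_of s'.
Proof.
move=> ss'; apply: acyc_ext => x y; rewrite !arc_orientation_of.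
case xy: (sedge x y) => //=; apply/idP/idP; first exact: ss'.
case: (ltngtP (lab_inv s x) (lab_inv s y)) => //.
  by rewrite sedge_sym in xy; move=> /(ss' _ _ xy); lia.
by move=> /val_inj/lab_inv_inj eq_xy; rewrite eq_xy sedge_irrefl in xy.
Qed.

Lemma swap_orientation (q : nat) (G : sgraph) (s s' : labeling q G) (i j : 'I_q) :
  j = i.+1 :> nat -> ~~ sedge (s i) (s j) -> (forall k, s' k = s (tperm i j k)) ->
  orientation_of s = orientation_of s'.
Proof.
move=> ij nE s'E.
have s'I x : lab_inv s' x = tperm i j (lab_inv s x).
  by apply: (lab_inj (s := s')); rewrite lab_invK s'E tpermK lab_invK.
apply: eq_orientation_of => x y exy ltxy; rewrite !s'I.
case: tpermP => [xi|xj|/eqP xi /eqP xj]; case: tpermP => [yi|yj|/eqP yi /eqP yj] //;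
  rewrite ?xi ?xj ?yi ?yj in ltxy *; try lia.
- by rewrite -[x](lab_invK s) -[y](lab_invK s) xi yj (negbTE nE) in exy.
- by move: yi yj; rewrite -!val_eqE /=; lia.
- by move: xi xj; rewrite -!val_eqE /=; lia.
Qed.

(** * Connecting linear extensions of one orientation by adjacent swaps *)

Section AdjacentSwaps.
Variables (q : nat) (G : sgraph) (Q : labeling q G -> labeling q G -> Prop).
Hypothesis Q_refl : forall s, Q s s.
Hypothesis Q_trans : forall s1 s2 s3, Q s1 s2 -> Q s2 s3 -> Q s1 s3.
Hypothesis Q_swap : forall (s s' : labeling q G) (i j : 'I_q),
  j = i.+1 :> nat -> ~~ sedge (s i) (s j) ->
  (forall k, s' k = s (tperm i j k)) -> Q s s'.

(** Monotonicity gives [i <= h i], and since [h] permutes ['I_q] both sides have the same sum, so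
    equality holds termwise. *)
Lemma ltn_homo_ord_id (h : 'I_q -> 'I_q) :
  injective h -> (forall i j : 'I_q, j = i.+1 :> nat -> h i < h j) -> h =1 id.
Proof.
move=> h_inj h_mono.
have le_h k : forall i : 'I_q, i = k :> nat -> i <= h i.
  elim: k => [|k IHk] i ik; first by rewrite ik.
  have kq : k < q by have := ltn_ord i; lia.
  have := IHk (Ordinal kq) erefl; have := h_mono (Ordinal kq) i ik.
  by rewrite /=; lia.
have [_] := leqif_sum (fun (i : 'I_q) (_ : true) => leqif_eq (le_h i i erefl)).
rewrite [X in _ == X](_ : _ = \sum_(i < q) i) ?eqxx; last first.
  by rewrite [RHS](reindex_inj h_inj).
by move/esym/forallP=> eq_h i; apply/esym/val_inj/eqP/eq_h.
Qed.

(* Bubble sort towards s': the weight \sum_i i * s'^-1(s i) strictly increases *)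
(* when a descent of s'^-1 o s is swapped.                                     *)
Lemma linear_extension_swaps (s s' : labeling q G) :
  orientation_of s = orientation_of s' -> Q s s'.
Proof.
pose M (t : labeling q G) := \sum_(i < q) i * lab_inv s' (t i).
have M_le t : M t <= \sum_(i < q) q * q.
  by apply: leq_sum => i _; apply: leq_mul; apply: ltnW.
have [m] := ubnP ((\sum_(i < q) q * q) - M s); elim: m s => // m IHm s ltm ss'.
have [/forallP noD|/forallPn[i /forallPn[j]]] :=
  boolP [forall i : 'I_q, forall j : 'I_q,
    (j == i.+1 :> nat) ==> (lab_inv s' (s i) < lab_inv s' (s j))].
  have id_s : lab_inv s' \o s =1 id.
    apply: ltn_homo_ord_id => [|i j /eqP ij].
      by apply: inj_comp; [exact: lab_inv_inj|exact: lab_inj].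
    exact: (implyP (forallP (noD i) j)).
  suff -> : s = s' by [].
  apply: val_inj; rewrite /= [lab_pair s]surjective_pairing [RHS]surjective_pairing.
  have e1 i : s i = s' i by have := congr1 (lab s') (id_s i); rewrite /= lab_invK.
  congr (_, _); apply/ffunP=> x; first exact: e1.
  apply: (lab_inj (s := s)); rewrite -/(lab_inv s x) -/(lab_inv s' x).
  by rewrite lab_invK e1 lab_invK.
rewrite negb_imply -leqNgt => /andP[/eqP ij le_ji].
have neq_ij : i != j by apply/eqP=> e; move: ij; rewrite e; lia.
have lt_ji : lab_inv s' (s j) < lab_inv s' (s i).
  rewrite ltn_neqAle le_ji andbT; apply: contra neq_ij => /eqP/val_inj.
  by move/lab_inv_inj/lab_inj->.
have [|t tE] := @ex_labeling q G (fun k => s (tperm i j k)) _ (card_labeling s).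
  by move=> k l /lab_inj/perm_inj.
(* An edge between these two tokens would be oriented in opposite ways by [s] and [s']. *)
have nE : ~~ sedge (s i) (s j).
  apply/negP=> e; have := arc_orientation_of s (s i) (s j).
  by rewrite ss' arc_orientation_of e !labK; lia.
apply: Q_trans (Q_swap ij nE tE) _; apply: IHm; last first.
  by rewrite -(swap_orientation ij nE tE).
suff : M s < M t by have := M_le t; lia.
have ME u : M u = i * lab_inv s' (u i) + (j * lab_inv s' (u j) +
    \sum_(k < q | (k != i) && (k != j)) k * lab_inv s' (u k)).
  by rewrite /M (bigD1 i) //= (bigD1 j) //= eq_sym.
rewrite !ME !tE tpermL tpermR ij !mulSn.
rewrite [X in _ < _ + (_ + X)](eq_bigr (fun k : 'I_q => k * lab_inv s' (s k))).
  by rewrite !addnA ltn_add2r; lia.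
by move=> k /andP[ki kj]; rewrite tE tpermD // eq_sym.
Qed.

End AdjacentSwaps.

(** * Infinite words and their shifts *)

Section Words.
Variable X : sgraph.
Implicit Types (F G H : nat -> X) (e : X -> nat) (u v : X).

Definition nocomm u v := (u != v) && ~~ sedge u v.

Lemma nocomm_sym u v : nocomm u v = nocomm v u.
Proof. by rewrite /nocomm eq_sym sedge_sym. Qed.

Definition cnt F v k := \sum_(i < k) (F i == v).

Lemma cnt0 F v : cnt F v 0 = 0.
Proof. by rewrite /cnt big_ord0. Qed.

Lemma cntS F v k : cnt F v k.+1 = cnt F v k + (F k == v).
Proof. by rewrite /cnt big_ord_recr. Qed.

Lemma cntD F v a k : cnt F v (k + a) = cnt F v a + cnt (fun i => F (i + a)) v k.
Proof.
elim: k => [|k IHk]; first by rewrite cnt0 addn0.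
by rewrite addSn !cntS IHk addnA.
Qed.

Lemma leq_cnt F v k l : k <= l -> cnt F v k <= cnt F v l.
Proof. by move=> /subnK <-; rewrite cntD leq_addr. Qed.

Lemma ltn_cnt F v k l : F k = v -> k < l -> cnt F v k < cnt F v l.
Proof. by move=> Fk /(leq_cnt F v); rewrite cntS Fk eqxx; lia. Qed.

Lemma ltn_cntE F v k l : F k = v -> (cnt F v k < cnt F v l) = (k < l).
Proof.
move=> Fk; apply/idP/idP; last exact: ltn_cnt.
by apply: contraTT; rewrite -!leqNgt; exact: leq_cnt.
Qed.

(** With [ex_cnt], this lets an occurrence of a letter be named by the number of earlier
    occurrences. *)
Lemma cnt_inj F v k l : F k = v -> F l = v -> cnt F v k = cnt F v l -> k = l.
Proof.
move=> Fk Fl kl; have := ltn_cntE l Fk; have := ltn_cntE k Fl.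
by rewrite kl ltnn; lia.
Qed.

Lemma eq_cnt F G v k : F =1 G -> cnt F v k = cnt G v k.
Proof. by move=> FG; apply: eq_bigr => i _; rewrite FG. Qed.

Lemma sum_cnt F (A : pred X) p : (forall i, i < p -> A (F i)) ->
  \sum_(v | A v) cnt F v p = p.
Proof.
move=> FA; rewrite exchange_big /= -[RHS]card_ord -sum1_card; apply: eq_bigr => i _.
rewrite (bigD1 (F i)) ?FA //= eqxx big1 // => v /andP[_ vF].
by rewrite eq_sym (negbTE vF).
Qed.

(* The infinite repetition of a word of length n with content c. *)
Definition pword n (c : X -> nat) F :=
  [/\ 0 < n, forall k, F (k + n) = F k & forall v, cnt F v n = c v].

(* The occurrences of each letter u of G correspond to those of F after        *)
(* skipping the first e u of them, and this correspondence preserves the       *)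
(* interleaving of any two letters that do not commute.                        *)
Definition shifted F G e := forall k l, F k = G l ->
  cnt F (F k) k = cnt G (F k) l + e (F k) ->
  forall v, nocomm (F k) v -> cnt F v k = cnt G v l + e v.

Lemma eq_shifted F G e e' : e =1 e' -> shifted F G e -> shifted F G e'.
Proof. by move=> ee' FG k l kl; rewrite -ee' => h v; rewrite -ee'; exact: FG. Qed.

Lemma eq_shifted_r F G G' e : G =1 G' -> shifted F G e -> shifted F G' e.
Proof.
move=> GG' FG k l; rewrite -GG' -(eq_cnt (F k) l GG') => kl h v.
by rewrite -(eq_cnt v l GG'); exact: FG.
Qed.

Lemma shifted_refl F : shifted F F (fun=> 0).
Proof.
by move=> k l kl; rewrite addn0 => /(cnt_inj erefl (esym kl)) -> v; rewrite addn0.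
Qed.

Lemma shifted_drop F a : shifted F (fun i => F (i + a)) (fun v => cnt F v a).
Proof.
move=> k l kl; rewrite addnC -cntD => /(cnt_inj erefl (esym kl)) -> v _.
by rewrite cntD addnC.
Qed.

Section PeriodicWords.
Variables (n : nat) (c : X -> nat).

Lemma cnt_period F v k : pword n c F -> cnt F v (k + n) = cnt F v k + c v.
Proof.
case=> _ Fn Fc; rewrite cntD Fc addnC; congr (_ + _).
by apply: eq_cnt => i; rewrite Fn.
Qed.

Lemma pword_gt0 F k : pword n c F -> 0 < c (F k).
Proof.
move=> Fp; have := cnt_period (F k) k Fp; have [n0 _ _] := Fp.
by have := @ltn_cnt F (F k) k (k + n) erefl; lia.
Qed.

Lemma cnt_eq0 F v k : pword n c F -> c v = 0 -> cnt F v k = 0.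
Proof.
move=> Fp cv; rewrite /cnt big1 // => i _.
by case: eqP => // Fi; have := pword_gt0 i Fp; rewrite Fi cv.
Qed.

Lemma ex_cnt F u j : pword n c F -> 0 < c u -> exists2 k, F k = u & cnt F u k = j.
Proof.
move=> Fp cu.
have cn i : cnt F u (i * n) = i * c u.
  elim: i => [|i IHi]; first by rewrite mul0n cnt0.
  by rewrite mulSn addnC cnt_period // IHi mulSn addnC.
have exj : exists m, j < cnt F u m by exists (j.+1 * n); rewrite cn; nia.
(* The shortest prefix with more than [j] occurrences of [u] ends in the one wanted. *)
case: (ex_minnP exj) => -[|k]; first by rewrite cnt0.
rewrite cntS => jk kmin; exists k; case: eqP jk => // Fk jk;
  by have := kmin k; lia.
Qed.

Lemma shifted_trans F G H e e' e'' : pword n c F -> pword n c G ->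
  shifted F G e -> shifted G H e' -> (forall v, e'' v = e v + e' v) ->
  shifted F H e''.
Proof.
move=> Fp Gp FG GH ee k l kl; rewrite ee => hk v uv.
have [m Gm hm] := ex_cnt (cnt H (F k) l + e' (F k)) Gp (pword_gt0 k Fp).
have := GH m l; rewrite Gm => /(_ kl hm v uv) h1.
have := FG k m (esym Gm); rewrite hm => /(_ _ v uv).
by rewrite ee h1; lia.
Qed.

Lemma shifted_period F : pword n c F -> shifted F F c.
Proof.
move=> Fp k l kl; rewrite -cnt_period // => /cnt_inj -> // => [v _|].
  by rewrite cnt_period.
by have [_ Fn _] := Fp; rewrite Fn.
Qed.

Section SelfShifts.
Variables (F : nat -> X).
Hypothesis Fp : pword n c F.

Lemma shiftedM e x : shifted F F e -> shifted F F (fun v => x * e v).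
Proof.
move=> Fe; elim: x => [|x IHx]; first exact: (eq_shifted _ (@shifted_refl F)).
by apply: (shifted_trans Fp Fp Fe IHx) => v; rewrite mulSn.
Qed.

(** From [k], skip further by [e'] to an occurrence [m]; seen from [l], it is reached by skipping
    [e]. Subtracting the two counts leaves the shift by [e'']. *)
Lemma shiftedB e e' e'' : shifted F F e -> shifted F F e' ->
  (forall v, e v = e' v + e'' v) -> shifted F F e''.
Proof.
move=> Fe Fe' ee k l kl hk v uv.
have [m Fm hm] := ex_cnt (cnt F (F k) k + e' (F k)) Fp (pword_gt0 k Fp).
have := Fe' m k Fm; rewrite Fm hm => /(_ erefl v uv) h1.
have := Fe m l; rewrite Fm hm ee hk => /(_ kl); rewrite -addnA (addnC (e'' _)).
by move=> /(_ erefl v uv); rewrite h1 ee; lia.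
Qed.

(** Repeating [e] for [c u] times and the full period for [e u] times skips equally many occurrences
    of [u]. Both shifts therefore relate the same two positions, and the occurrences of [v] between
    them are counted in two ways. *)
Lemma shifted_rate e u v : shifted F F e -> 0 < c u -> nocomm u v ->
  e u * c v = e v * c u.
Proof.
move=> Fe cu uv; have [l Fl _] := ex_cnt 0 Fp cu.
have [m Fm hm] := ex_cnt (cnt F u l + c u * e u) Fp cu.
have := @shiftedM e (c u) Fe m l.
rewrite Fl Fm => /(_ erefl hm v uv) h1.
have := @shiftedM c (e u) (shifted_period Fp) m l.
rewrite Fl Fm hm mulnC => /(_ erefl erefl v uv); lia.
Qed.

(* Whichever of u and v occurs first in F, its occurrence after skipping e of  *)
(* them separates the two blocks.                                              *)
Lemma shifted_block e u v k l : shifted F F e -> nocomm u v ->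
  F k = u -> F l = v -> e u <= cnt F u k -> cnt F v l < e v -> l < k.
Proof.
move=> Fe uv Fk Fl uk vl.
have cu : 0 < c u by rewrite -Fk; exact: pword_gt0.
have cv : 0 < c v by rewrite -Fl; exact: pword_gt0.
have [ku Fku hku] := ex_cnt 0 Fp cu; have [kv Fkv hkv] := ex_cnt 0 Fp cv.
have [mu Fmu hmu] := ex_cnt (e u) Fp cu; have [mv Fmv hmv] := ex_cnt (e v) Fp cv.
have := Fe mu ku; rewrite Fmu Fku hmu hku => /(_ erefl erefl v uv) hu.
have := Fe mv kv; rewrite Fmv Fkv hmv hkv => /(_ erefl erefl u).
rewrite nocomm_sym => /(_ uv) hv.
have := ltn_cntE mv Fl; have := ltn_cntE mu Fl; have := ltn_cntE mu Fk.
have := ltn_cntE mv Fk; have := ltn_cntE kv Fku; have := ltn_cntE ku Fkv.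
have := leq_cnt F v (k := mu) (l := l); have := leq_cnt F u (k := kv) (l := ku).
have := leq_cnt F v (k := ku) (l := kv).
by lia.
Qed.

End SelfShifts.
End PeriodicWords.

(** [P] marks the left ends of the disjoint pairs of neighbouring positions that are exchanged. The
    exchanged letters commute, so no letter is moved past one it does not commute with. *)
Lemma shifted_swap F G (P : pred nat) :
    (forall k, P k -> ~~ P k.+1) ->
    (forall k, P k -> G k = F k.+1 /\ G k.+1 = F k) ->
    (forall k, P k -> sedge (F k) (F k.+1)) ->
    (forall k, ~~ P k -> ~~ ((0 < k) && P k.-1) -> G k = F k) ->
  shifted F G (fun=> 0).
Proof.
move=> P1 P2 P3 P4.
(* Prefixes that do not cut an exchanged pair have the same content. *)
have cG v k : ~~ ((0 < k) && P k.-1) -> cnt G v k = cnt F v k.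
  have [m] := ubnP k; elim: m k => // m IHm [|k] ltm; first by rewrite !cnt0.
  rewrite /= => Pk; rewrite !cntS.
  have [/andP[k0 Pk1]|nPk1] := boolP ((0 < k) && P k.-1); last first.
    by rewrite IHm ?P4 //; lia.
  case: k => // k in ltm Pk k0 Pk1 *; rewrite /= in Pk1; have [G1 G2] := P2 _ Pk1.
  rewrite !cntS G1 G2 IHm; [by rewrite addnAC|by lia|].
  by apply/negP=> /andP[k1 Pk2]; move: Pk1; rewrite -(prednK k1) (negbTE (P1 _ Pk2)).
move=> k l kl; rewrite addn0 => hk v uv; rewrite addn0.
(* It is enough to follow the letter at [k] into [G]: it stands at [k.+1], [k.-1] or [k], according
   to whether [k] opens a pair, closes one, or is left alone. *)
suff [k' Gk' hk'] : exists2 k', G k' = F k &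
    forall w, w = F k \/ nocomm (F k) w -> cnt G w k' = cnt F w k.
  rewrite -(hk' v (or_intror uv)); congr (cnt _ _ _).
  by apply: (cnt_inj Gk' (esym kl)); rewrite hk' //; left.
have noE w u : w = u \/ nocomm u w -> sedge u w = false.
  by case=> [->|/andP[_ /negbTE]//]; rewrite sedge_irrefl.
have [Pk|nPk] := boolP (P k).
  have [Gk Gk1] := P2 _ Pk; exists k.+1 => // w /noE kw.
  rewrite cntS Gk cG; last first.
    by apply/negP=> /andP[k0 /P1]; rewrite prednK // Pk.
  by case: eqP => [wE|]; [move: kw; rewrite -wE P3 | rewrite addn0].
have [/andP[k0 Pk1]|nPk1] := boolP ((0 < k) && P k.-1); last first.
  by exists k => [|w _]; [exact: P4|exact: cG].
case: k => // k in hk uv kl nPk k0 Pk1 *; rewrite /= in Pk1; have [Gk Gk1] := P2 _ Pk1.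
exists k => // w /noE kw; rewrite cG; last first.
  by apply/negP=> /andP[k1 /P1]; rewrite prednK // Pk1.
rewrite cntS; case: eqP => [wE|]; last by rewrite addn0.
by move: kw; rewrite -wE sedge_sym P3.
Qed.

End Words.

Lemma sedge_connect_sym (G : sgraph) : connect_sym (@sedge G).
Proof. exact: sym_connect_sym (@sedge_sym G). Qed.

Lemma in_component (G : sgraph) (x y : G) : (y \in component x) = connect sedge x y.
Proof. by rewrite inE. Qed.

Lemma eq_component (G : sgraph) (x y : G) :
  connect sedge x y -> component x = component y.
Proof.
by move=> xy; apply/setP=> z; rewrite !inE (same_connect (@sedge_connect_sym G) xy).
Qed.

Definition modord n k : 'I_n.+1 := Ordinal (ltn_pmod k (ltn0Sn n)).

Lemma modord_ord n (i : 'I_n.+1) : modord n i = i.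
Proof. by apply: val_inj; rewrite /= modn_small. Qed.

Lemma iter_ordS_modord n a k : iter a (@ordS n.+1) (modord n k) = modord n (k + a).
Proof. by apply: val_inj; rewrite [LHS]val_iter_ordS /= modnDml. Qed.

(** * Vertices of FS as periodic words; swaps and rotations of labelings *)

Section ColiftWords.
Variables (X : mgraph) (n : nat).
Local Notation N := n.+1.
Implicit Types (f g : FS N X) (s : labeling N (colift X)).

Lemma colift_edgeE (x y : colift X) : sedge x y = nocomm (proj x) (proj y).
Proof.
rewrite /sedge /= /compl_edge /nocomm /proj /= /lift_edge /=.
have [xy|nxy] := eqVneq (tag x) (tag y); first by rewrite andbN.
by case: eqP => // xy; rewrite xy eqxx in nxy.
Qed.

(** Periodic repetition turns rotation into dropping a prefix. *)
Definition word f k : X := val f (modord n k).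

Lemma word_inj f g : word f =1 word g -> f = g.
Proof.
move=> fg; apply/val_inj/ffunP=> i.
by have := fg i; rewrite /word modord_ord.
Qed.

Lemma word_ord f (i : 'I_N) : word f i = val f i.
Proof. by rewrite /word modord_ord. Qed.

Lemma word_rotate a f k : word (iter a (@rotate N X) f) k = word f (k + a).
Proof.
elim: a k => [|a IHa] k; first by rewrite addn0.
rewrite addnS -addSn -IHa iterS /word /= ffunE.
by congr (_ _); have := iter_ordS_modord n 1 k; rewrite addn1.
Qed.

Lemma pword_word f : pword N mult (word f).
Proof.
split=> // [k|v]; first by congr (sval f _); apply: val_inj; rewrite /= modnDr.
rewrite -(eqP (forallP (valP f) v)) -sum1_card big_mkcond /cnt.
by apply: eq_bigr => i _; rewrite !inE word_ord; case: eqP.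
Qed.

Lemma rotate_period m f : iter (m * N) (@rotate N X) f = f.
Proof.
apply: word_inj => k; rewrite word_rotate /word; congr (sval f _).
by apply: val_inj; rewrite /= addnC modnMDl.
Qed.

Lemma word_labeling s k : word (labeling_vertex s) k = proj (s (modord n k)).
Proof. by rewrite /word /= ffunE. Qed.

Lemma labeling_vertexE s i : val (labeling_vertex s) i = proj (s i).
Proof. by rewrite /= ffunE. Qed.

Section Swap.
Variables (s s' : labeling N (colift X)) (i j : 'I_N).
Hypothesis ij : j = i.+1 :> nat.
Hypothesis nE : ~~ sedge (s i) (s j).
Hypothesis s'E : forall k, s' k = s (tperm i j k).

Lemma swap_cases : labeling_vertex s' = labeling_vertex s \/
  sedge (proj (s i)) (proj (s j)).
Proof.
move: nE; rewrite colift_edgeE negb_and !negbK => /orP[/eqP p_ij|]; last by right.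
left; apply/val_inj/ffunP=> k; rewrite !ffunE s'E.
by case: tpermP => [->|->|].
Qed.

Lemma swap_connect : connect sedge (labeling_vertex s) (labeling_vertex s').
Proof.
have [-> //|e] := swap_cases.
apply/connect1/existsP; exists i; apply/existsP; exists j.
rewrite !labeling_vertexE e /=; apply/andP; split; last first.
  by apply/forallP=> k; rewrite !ffunE s'E tpermK.
rewrite /cycle_edge /= -!val_eqE /= ij modn_small ?eqxx; last by rewrite -ij.
by rewrite andbT; apply/eqP; lia.
Qed.

Lemma swap_shifted :
  shifted (word (labeling_vertex s)) (word (labeling_vertex s')) (fun=> 0).
Proof.
have [->|e] := swap_cases; first exact: shifted_refl.
have modS k : k %% N = i -> k.+1 %% N = j.
  move=> ki; rewrite -addn1 -modnDml ki addn1 modn_small ?ij //.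
  by rewrite -ij.
have iE k : k %% N = i -> modord n k = i by move=> ki; apply: val_inj.
have jE k : k %% N = i -> modord n k.+1 = j by move=> ki; apply/val_inj/modS.
apply: (@shifted_swap _ _ _ (fun k => k %% N == i)) => k.
- by move/eqP/modS=> ->; rewrite ij; lia.
- by move=> /eqP ki; rewrite !word_labeling !s'E iE // jE // tpermL tpermR.
- by move=> /eqP ki; rewrite !word_labeling iE // jE.
move=> ki kj; rewrite !word_labeling s'E tpermD //.
  by apply: contra ki => /eqP ->.
apply: contra kj => /eqP jk; have /= jk' := congr1 val jk.
have k0 : 0 < k by case: k jk' {ki jk} => //; rewrite mod0n; lia.
rewrite k0 /=; have := modnS k.-1 N; rewrite prednK // -jk' ij.
by case: ifP => // _ [->].
Qed.
End Swap.

Lemma same_orientation_connect s s' : orientation_of s = orientation_of s' ->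
  connect sedge (labeling_vertex s) (labeling_vertex s').
Proof.
apply: (linear_extension_swaps
  (Q := fun s s' => is_true (connect sedge (labeling_vertex s) (labeling_vertex s')))).
- by move=> ?; exact: connect0.
- by move=> ???; exact: connect_trans.
- by move=> ????; exact: swap_connect.
Qed.

Lemma same_orientation_shifted s s' : orientation_of s = orientation_of s' ->
  shifted (word (labeling_vertex s)) (word (labeling_vertex s')) (fun=> 0).
Proof.
apply: (linear_extension_swaps (Q := fun s s' =>
  shifted (word (labeling_vertex s)) (word (labeling_vertex s')) (fun=> 0))).
- by move=> ?; exact: shifted_refl.
- move=> s1 s2 s3 h12 h23.
  exact: (shifted_trans (pword_word _) (pword_word _) h12 h23).
- by move=> ????; exact: swap_shifted.
Qed.

Lemma connect_rotate k f g :
  connect sedge (iter k (@rotate N X) f) (iter k (@rotate N X) g) = connect sedge f g.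
Proof.
have homo m f1 f2 : connect sedge f1 f2 ->
    connect sedge (iter m (@rotate N X) f1) (iter m (@rotate N X) f2).
  case/connectP=> p; elim: p f1 => [|h p IHp] f1 /=; first by move=> _ ->.
  case/andP=> f1h hp lst; apply: connect_trans (connect1 _) (IHp _ hp lst).
  by elim: m {IHp} => // m IHm; rewrite !iterS sedge_rotate.
apply/idP/idP; last exact: homo.
(* Rotating by [k * N - k] inverts rotating by [k]; this natural-number form of the inverse recurs
   below. *)
move/(homo (k * N - k)); rewrite -!iterD subnK ?rotate_period //.
by rewrite leq_pmulr.
Qed.

Lemma source_first s : source (orientation_of s) (s ord0).
Proof. by apply/forallP=> y; rewrite arc_orientation_of labK andbF. Qed.

Lemma rotate_labeling s : exists2 s',
  forall u v, arc (orientation_of s') u v =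
    (if (u == s ord0) || (v == s ord0) then arc (orientation_of s) v u
     else arc (orientation_of s) u v)
  & labeling_vertex s' = rotate (labeling_vertex s).
Proof.
have [|s' s'E] := @ex_labeling N _ (fun k => s (ordS k)) _ (card_labeling s).
  by move=> k l /lab_inj/ordS_inj.
have s'I x : lab_inv s' x = ord_pred (lab_inv s x).
  by apply: (lab_inj (s := s')); rewrite lab_invK s'E ord_predK lab_invK.
exists s'; last by apply/val_inj/ffunP=> i; rewrite !ffunE s'E.
have predE (i : 'I_N) : ord_pred i = (if i == ord0 then n else i.-1) :> nat.
  rewrite /=; case: i => -[|i] //= lti; first by rewrite modn_small.
  by rewrite modnDr modn_small //; lia.
have inv0 x : (lab_inv s x == ord0) = (x == s ord0).
  by apply/eqP/eqP=> [<-|->]; rewrite ?lab_invK ?labK.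
move=> x y; rewrite !arc_orientation_of !s'I !predE !inv0.
rewrite (sedge_sym y x); case exy: (sedge x y); last by rewrite !if_same.
rewrite /=; have ltx := ltn_ord (lab_inv s x); have lty := ltn_ord (lab_inv s y).
have := inv0 x; have := inv0 y; rewrite -!(val_eqE _ ord0) /=.
have [xE|nx] := eqVneq x (s ord0); have [yE|ny] := eqVneq y (s ord0) => /=; lia.
Qed.

End ColiftWords.

(** * Equivalence classes of orientations against components up to rotation *)

Section Simeq.
Variables (X : mgraph) (n : nat).
Local Notation N := n.+1.
Implicit Types (f g : FS N X) (s : labeling N (colift X)) (a b : acyc (colift X)).

Lemma simeq_sym a b : simeq a b = simeq b a.
Proof.
apply: sym_connect_sym => {}a {}b /=.
by rewrite orbA (orbC (flip_equiv a b)) -orbA [in RHS](orbC (perm_equiv b a)).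
Qed.

Lemma simeq_trans a b c : simeq a b -> simeq b c -> simeq a c.
Proof. exact: connect_trans. Qed.

Lemma flip_simeq a b : flip a b -> simeq a b.
Proof. by move=> ab; apply/connect1/orP; left; exact: connect1. Qed.

Lemma perm_equiv_simeq a b : perm_equiv a b -> simeq a b.
Proof. by move=> ab; apply/connect1; rewrite /= ab !orbT. Qed.

(** The permutation [s' \o lab_inv s] preserves letters. *)
Lemma same_vertex_perm_equiv s s' : labeling_vertex s = labeling_vertex s' ->
  perm_equiv (orientation_of s) (orientation_of s').
Proof.
move=> ss'; have pE i : proj (s i) = proj (s' i).
  by rewrite -!labeling_vertexE ss'.
have r_inj : injective (fun x => s' (lab_inv s x)).
  by move=> x y /lab_inj/lab_inv_inj.
have rp x : proj (perm r_inj x) = proj x by rewrite permE -pE lab_invK.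
apply/existsP; exists (perm r_inj); apply/andP; split.
  rewrite inE; apply/forallP=> v.
  rewrite eqEcard card_imset ?leqnn ?andbT; last exact: perm_inj.
  by apply/subsetP=> y /imsetP[x]; rewrite !inE => xv ->; rewrite rp.
apply/forallP=> x; apply/forallP=> y.
by rewrite !arc_orientation_of !colift_edgeE !rp !permE !labK.
Qed.

Lemma rotate_labeling_simeq k s : exists2 s',
  simeq (orientation_of s) (orientation_of s')
  & labeling_vertex s' = iter k (@rotate N X) (labeling_vertex s).
Proof.
elim: k => [|k [s1 ss1 s1E]]; first by exists s => //; exact: connect0.
have [s2 s12 s2E] := rotate_labeling s1; exists s2; last by rewrite s2E s1E.
apply: simeq_trans ss1 (flip_simeq _).
apply/existsP; exists (s1 ord0); rewrite source_first /=.
by apply/forallP=> u; apply/forallP=> v; rewrite s12.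
Qed.

Lemma ex_labeling_vertex f : #|colift X| = N -> exists s, labeling_vertex s = f.
Proof.
(* Position [i] receives the copy of its letter numbered by the rank of [i] among the positions
   carrying that letter. *)
move=> cX; pose r (i : 'I_N) := index i (enum (val f @^-1: [set val f i])).
have rP i : r i < mult (val f i).
  rewrite -(eqP (forallP (valP f) (val f i))) cardE index_mem mem_enum.
  by rewrite !inE.
pose t (i : 'I_N) : colift X :=
  Tagged (fun v => 'I_(mult v)) (Ordinal (rP i)).
have t_inj : injective t.
  move=> i j ij; have eij : val f i = val f j := congr1 (@tag _ _) ij.
  have := congr1 (fun x : lift_vertex X => nat_of_ord (tagged x)) ij.
  rewrite /= /r eij => /(index_inj i); apply; rewrite mem_enum !inE //.
  by rewrite eij.
have [s sE] := ex_labeling t_inj cX; exists s.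
by apply/val_inj/ffunP=> i; rewrite ffunE sE.
Qed.

Lemma val_iter_rotate k f i :
  val (iter k (@rotate N X) f) i = val f (iter k (@ordS N) i).
Proof. by elim: k i => //= k IHk i; rewrite ffunE IHk -iterSr. Qed.

(** The exchanged pair may wrap around the end of the cycle. Rotating it to positions 0 and 1 makes
    the edge an adjacent swap of tokens not joined in the colift, which keeps the orientation. *)
Lemma FS_edge_rotate f g : #|colift X| = N -> sedge f g ->
  exists k s s', [/\ labeling_vertex s = iter k (@rotate N X) f,
    labeling_vertex s' = iter k (@rotate N X) g
    & orientation_of s = orientation_of s'].
Proof.
move=> cX /existsP[a /existsP[b /and3P[ab fab /forallP fg]]].
wlog bE : a b ab fab fg / b == ordS a.
  move=> wl; have /andP[_ /orP[bE|aE]] := ab; first exact: (wl a b).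
  apply: (wl b a) => //; first by rewrite sedge_sym.
    by rewrite sedge_sym.
  by move=> i; rewrite tpermC.
have nab : a != b by have /andP[] := ab.
have n1 : 1 < N.
  case: (n) a b nab {ab fab fg bE} => [|m] a b //.
  by rewrite (ord1 a) (ord1 b) eqxx.
pose i0 : 'I_N := ord0; pose i1 : 'I_N := Ordinal n1.
pose phi := iter a (@ordS N).
have phi_inj : injective phi.
  by rewrite /phi; elim: (nat_of_ord a) => [|m IHm] x y //= /ordS_inj/IHm.
have phi0 : phi i0 = a.
  by apply: val_inj; rewrite /phi [LHS]val_iter_ordS add0n modn_small.
have phi1 : phi i1 = b.
  rewrite (eqP bE) -phi0; apply: val_inj.
  rewrite /phi -[RHS]/(val (iter a.+1 (@ordS N) i0)).
  by rewrite [LHS]val_iter_ordS [RHS]val_iter_ordS.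
have [s sE] := ex_labeling_vertex (iter a (@rotate N X) f) cX.
have [|s' s'E] := @ex_labeling N _ (fun k => s (tperm i0 i1 k)) _ cX.
  by move=> k l /lab_inj/perm_inj.
have pE i : proj (s i) = val f (phi i) by rewrite -labeling_vertexE sE val_iter_rotate.
exists a, s, s'; split=> //.
  apply/val_inj/ffunP=> i; rewrite ffunE s'E pE val_iter_rotate (eqP (fg _)).
  congr (sval g _); rewrite -[RHS]/(phi i) -phi0 -phi1.
  by rewrite (inj_tperm _ _ _ phi_inj) tpermK.
apply: (swap_orientation (i := i0) (j := i1)) s'E => //.
by rewrite colift_edgeE !pE phi0 phi1 /nocomm fab andbF.
Qed.

Lemma FS_edge_simeq s s' : sedge (labeling_vertex s) (labeling_vertex s') ->
  simeq (orientation_of s) (orientation_of s').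
Proof.
move=> /(FS_edge_rotate (card_labeling s)) [k [t [t' [tE t'E tt']]]].
have [u su uE] := rotate_labeling_simeq k s.
have [u' s'u' u'E] := rotate_labeling_simeq k s'.
have := @same_vertex_perm_equiv u t; rewrite uE tE => /(_ erefl)/perm_equiv_simeq ut.
have := @same_vertex_perm_equiv t' u'; rewrite u'E t'E => /(_ erefl)/perm_equiv_simeq tu.
apply: simeq_trans su _; apply: simeq_trans ut _; rewrite tt'.
by apply: simeq_trans tu _; rewrite simeq_sym.
Qed.

Lemma connect_simeq k s s' :
  connect sedge (labeling_vertex s) (iter k (@rotate N X) (labeling_vertex s')) ->
  simeq (orientation_of s) (orientation_of s').
Proof.
have [t s't <-] := rotate_labeling_simeq k s'.
rewrite simeq_sym in s't; move=> st; apply: simeq_trans s't.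
case/connectP: st => p; elim: p s => [|g p IHp] s /=.
  by move=> _ ts; apply/perm_equiv_simeq/same_vertex_perm_equiv.
case/andP; have [s1 <-] := ex_labeling_vertex g (card_labeling s).
by move=> /FS_edge_simeq ss1 pth lst; apply: simeq_trans ss1 (IHp _ pth lst).
Qed.

Definition rot_connect f g := exists k, connect sedge f (iter k (@rotate N X) g).

Lemma rot_connect_sym f g : rot_connect f g -> rot_connect g f.
Proof.
case=> k; rewrite -(connect_rotate (k * N - k)) -iterD subnK ?leq_pmulr //.
by rewrite rotate_period sedge_connect_sym => gf; exists (k * N - k).
Qed.

Lemma rot_connect_trans f g h :
  rot_connect f g -> rot_connect g h -> rot_connect f h.
Proof.
move=> [k fg] [l gh]; exists (k + l); rewrite iterD.
by apply: connect_trans fg _; rewrite connect_rotate.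
Qed.

Definition lv_rel a b := forall s s', linear_extension a s ->
  linear_extension b s' -> rot_connect (labeling_vertex s) (labeling_vertex s').

Lemma same_lv_rel a : lv_rel a a.
Proof.
move=> s s' /eqP sa /eqP s'a; exists 0.
by apply: same_orientation_connect; rewrite sa.
Qed.

Lemma lv_rel_sym a b : lv_rel a b -> lv_rel b a.
Proof. by move=> ab s s' sb s'a; apply: rot_connect_sym; exact: ab. Qed.

Hypothesis cX : #|colift X| = N.

Lemma ex_linear_extensionN a : exists s, linear_extension a s.
Proof. by rewrite -cX; exact: ex_linear_extension. Qed.

Lemma lv_rel_trans a b c : lv_rel a b -> lv_rel b c -> lv_rel a c.
Proof.
move=> ab bc s s' sa s'c; have [t tb] := ex_linear_extensionN b.
exact: rot_connect_trans (ab _ _ sa tb) (bc _ _ tb s'c).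
Qed.

(** A source can be put first in a linear extension of [a]; rotating that labeling by one step then
    performs the flip. *)
Lemma flip_source_lv_rel a b x : source a x ->
  (forall u v, arc b u v = if (u == x) || (v == x) then arc a v u else arc a u v) ->
  lv_rel a b.
Proof.
move=> ax bE s s' sa s'b; have /eqP sa' := sa.
pose w := x :: filter (predC1 x) (codom s).
have w_uniq : uniq w.
  rewrite /= mem_filter /= eqxx /= filter_uniq //.
  exact: (codom_uniq s).
have w_all y : y \in w.
  rewrite inE mem_filter /=; case: eqP => //= _.
  by rewrite -(lab_invK s y) codom_f.
have [t tI tE] := ex_labeling_seq w_uniq w_all cX.
have ta : linear_extension a t.
  rewrite /linear_extension -sa'; apply/eqP/esym/eq_orientation_of => y z yz lt_yz.
  have nz : z != x.
    apply: contraTneq ax => zx; apply/forallPn; exists y; rewrite negbK -sa'.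
    by rewrite arc_orientation_of -zx yz.
  rewrite !tI /= !(eq_sym x) (negbTE nz); case: (eqVneq y x) => // ny.
  by rewrite ltnS index_filter_lt //= !(index_codom s).
have t0 : t ord0 = x by rewrite (tE x).
have [t1 t1E t1V] := rotate_labeling t.
have t1b : linear_extension b t1.
  apply/eqP/acyc_ext => u v; rewrite t1E bE t0.
  by rewrite (eqP ta).
apply: rot_connect_trans (same_lv_rel sa ta) _.
apply: rot_connect_trans (same_lv_rel t1b s'b).
by apply: rot_connect_sym; exists 1; rewrite t1V.
Qed.

Lemma flip_lv_rel a b : flip a b -> lv_rel a b.
Proof.
case/existsP=> x /andP[/orP[ax|ax] /forallP bE].
  by apply: (flip_source_lv_rel ax) => u v; apply/eqP; have /forallP := bE u.
have {}bE u v : arc b u v = if (u == x) || (v == x) then arc a v u else arc a u v.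
  by apply/eqP; have /forallP := bE u.
(* A sink of [a] is a source of [b], and flipping it back gives [a]. *)
apply/lv_rel_sym/(flip_source_lv_rel (x := x)).
  by apply/forallP=> y; rewrite bE eqxx orbT; exact: (forallP ax).
by move=> u v; rewrite !bE (orbC (v == x)); case: (_ || _).
Qed.

Lemma perm_equiv_lv_rel a b : perm_equiv a b -> lv_rel a b.
Proof.
case/existsP=> r /andP[]; rewrite inE => /forallP rX /forallP ab s s' /eqP sa s'b.
have [|t tE] := @ex_labeling N _ (fun k => r (s k)) _ cX.
  by move=> k l /perm_inj/lab_inj.
have tI x : lab_inv t (r x) = lab_inv s x.
  by apply: (lab_inj (s := t)); rewrite lab_invK tE lab_invK.
have rp x : proj (r x) = proj x.
  have : r x \in r @: fiber (proj x) by apply: imset_f; rewrite inE.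
  by rewrite (eqP (rX _)) inE => /eqP.
have tb : linear_extension b t.
  apply/eqP/acyc_ext => u v; rewrite -(permKV r u) -(permKV r v).
  move: (r^-1 u)%g (r^-1 v)%g => {}u {}v.
  have /forallP/(_ v)/eqP <- := ab u; rewrite -sa !arc_orientation_of !tI.
  by rewrite !colift_edgeE !rp.
have -> : labeling_vertex s = labeling_vertex t.
  by apply/val_inj/ffunP=> i; rewrite !ffunE tE rp.
exact: same_lv_rel tb s'b.
Qed.

Lemma simeq_lv_rel a b : simeq a b -> lv_rel a b.
Proof.
have flipE c d : flip_equiv c d -> lv_rel c d.
  case/connectP=> p; elim: p c => [|e p IHp] c /=; first by move=> _ ->; exact: same_lv_rel.
  by case/andP=> /flip_lv_rel ce pth lst; apply: lv_rel_trans ce (IHp _ pth lst).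
case/connectP=> p; elim: p a => [|c p IHp] a /=; first by move=> _ ->; exact: same_lv_rel.
case/andP=> ac pth lst; apply: lv_rel_trans (IHp _ pth lst).
case/or4P: ac; first exact: flipE.
- by move/flipE/lv_rel_sym.
- exact: perm_equiv_lv_rel.
- by move/perm_equiv_lv_rel/lv_rel_sym.
Qed.

End Simeq.

(** * Rotating by the period on one component *)

Lemma nth_rot (T : Type) (x0 : T) p (w : seq T) i :
  p <= size w -> i < size w -> nth x0 (rot p w) i = nth x0 w ((i + p) %% size w).
Proof.
move=> pw iw; rewrite /rot nth_cat size_drop nth_drop.
case: ltnP => ip; first by rewrite addnC modn_small //; lia.
have -> : i + p = i - (size w - p) + size w by lia.
by rewrite modnDr modn_small ?nth_take //; lia.
Qed.

Definition edge_closed (G : sgraph) (Z : {set G}) :=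
  forall x y : G, sedge x y -> (x \in Z) = (y \in Z).

Lemma component_closed (G : sgraph) (x : G) : edge_closed (component x).
Proof.
move=> y z yz; rewrite !in_component; apply/idP/idP => xy.
  exact: connect_trans xy (connect1 yz).
by apply: connect_trans xy (connect1 _); rewrite sedge_sym.
Qed.

(** No edge leaves [Z], so only the relative orders inside [Z] and outside [Z] matter. *)
Lemma filter_orientation (q : nat) (G : sgraph) (Z : {set G}) (w w' : seq G)
    (s s' : labeling q G) :
  edge_closed Z ->
  (forall x, lab_inv s x = index x w :> nat) ->
  (forall x, lab_inv s' x = index x w' :> nat) ->
  (forall x y, x \in Z -> y \in Z -> sedge x y -> lab_inv s x < lab_inv s y ->
     index x (filter (mem Z) w') < index y (filter (mem Z) w')) ->
  filter (predC (mem Z)) w = filter (predC (mem Z)) w' ->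
  orientation_of s = orientation_of s'.
Proof.
move=> Zcl sI s'I eZ eC; apply: eq_orientation_of => x y xy lt_xy; rewrite !s'I.
have xyZ := Zcl _ _ xy; have [xZ|xZ] := boolP (x \in Z).
  rewrite -(index_filter_lt (P := mem Z)) //=; last by rewrite -xyZ.
  by apply: eZ => //; rewrite -xyZ.
rewrite -(index_filter_lt (P := predC (mem Z))) //=; last by rewrite -xyZ.
rewrite -eC index_filter_lt //=; last by rewrite -xyZ.
by rewrite -!sI.
Qed.

Section RotatePeriod.
Variables (X : mgraph) (n : nat).
Local Notation N := n.+1.
Variables (s : labeling N (colift X)) (Z : {set colift X}).
Hypothesis Zcl : edge_closed Z.
Local Notation q := #|induced Z|.
Local Notation pZ := (fun x : induced Z => proj (val x)).
Variables (sZ : labeling q (induced Z)) (p : nat).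
Hypothesis sZ_ext : linear_extension (restrict (orientation_of s) Z) sZ.
Hypothesis sZ_p : periodic pZ sZ p.
Hypothesis p_le : p <= q.

Let wZ : seq (colift X) := map val (codom sZ).
Let r := filter (predC (mem Z)) (codom s).

Lemma codom_labeling_filter :
  [/\ filter (mem Z) wZ = wZ, filter (predC (mem Z)) wZ = [::],
      filter (mem Z) r = [::] & filter (predC (mem Z)) r = r].
Proof.
have wZ_in : all (mem Z) wZ by apply/allP=> _ /mapP[x _ ->]; exact: valP.
have r_out : all (predC (mem Z)) r by rewrite filter_all.
split.
- exact/all_filterP.
- apply/eqP; rewrite -size_eq0 size_filter -leqn0 leqNgt -has_count -all_predC.
  by apply/allP=> x /(allP wZ_in) /= ->.
- apply/eqP; rewrite -size_eq0 size_filter -leqn0 leqNgt -has_count -all_predC.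
  by apply/allP=> x /(allP r_out) /=.
- exact/all_filterP.
Qed.

Let cX : #|colift X| = N := card_labeling s.

Lemma wZr_uniq : uniq (wZ ++ r).
Proof.
rewrite cat_uniq map_inj_uniq; last exact: val_inj.
rewrite (codom_uniq sZ) filter_uniq ?(codom_uniq s) // andbT /=.
apply/hasPn=> x; rewrite mem_filter => /andP[xZ _].
by apply: contra xZ => /mapP[y _ ->]; exact: valP.
Qed.

Lemma mem_wZr x : x \in wZ ++ r.
Proof.
rewrite mem_cat mem_filter (mem_codom_lab s) andbT /=.
have [xZ|_] := boolP (x \in Z); last by rewrite orbT.
by rewrite orbF; apply/mapP; exists (Sub x xZ : induced Z) => //; exact: (mem_codom_lab sZ).
Qed.

Lemma perm_labeling w : perm_eq w (wZ ++ r) ->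
  exists2 t : labeling N (colift X), forall x, lab_inv t x = index x w :> nat
    & forall (x0 : colift X) i, t i = nth x0 w i.
Proof.
move=> pw; apply: ex_labeling_seq => // [|x].
  by rewrite (perm_uniq pw) wZr_uniq.
by rewrite (perm_mem pw) mem_wZr.
Qed.

Lemma nth_wZ (v0 : X) (j : 'I_q) : nth v0 (map (@proj X) wZ) j = pZ (sZ j).
Proof.
rewrite /wZ -map_comp /codom /image_mem -map_comp.
by rewrite (nth_map j) -?enumT ?size_enum_ord // nth_ord_enum.
Qed.

(** Let [t] spell [wZ ++ r], [t1] its rotation by [p], and [t2] the word [rot p wZ ++ r]. In [t1]
    and [t2] the tokens of [Z] come in the same order, and so do the others, so the orientations
    agree; periodicity of [sZ] makes [t2] and [t] project to one vertex. The skip vector is the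
    content of the first [p] letters of [t], all of them letters of [Z]. *)
Lemma rotate_period_connect :
  connect sedge (iter p (@rotate N X) (labeling_vertex s)) (labeling_vertex s) /\
  exists e, [/\ shifted (word (labeling_vertex s)) (word (labeling_vertex s)) e,
    forall v, v \notin [set proj x | x in Z] -> e v = 0 &
    \sum_(v : X | v \in [set proj x | x in Z]) e v = p].
Proof.
have [f1 f2 f3 f4] := codom_labeling_filter.
have swZ : size wZ = q by rewrite size_map size_codom card_ord.
pose w := wZ ++ r.
have [t tI tE] := perm_labeling (perm_refl w).
have x0 : colift X := t ord0.
have sw : size w = N.
  by rewrite -(card_uniqP wZr_uniq) -cX; apply: eq_card => x; rewrite mem_wZr.
have ta : orientation_of s = orientation_of t.
  apply: (filter_orientation Zcl (w := codom s) _ tI) => [x||].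
  - by rewrite (index_codom s).
  - move=> x y xZ yZ xy lt_xy; rewrite filter_cat f1 f3 cats0.
    pose x' : induced Z := Sub x xZ; pose y' : induced Z := Sub y yZ.
    rewrite -[x]/(val x') -[y]/(val y') !index_map; try exact: val_inj.
    rewrite !(index_codom sZ).
    have := arc_orientation_of sZ x' y'; rewrite (eqP sZ_ext) /Defs.arc /= inE /=.
    by rewrite arc_orientation_of xy lt_xy => /esym/andP[].
  - by rewrite filter_cat f2 f4.
have pw1 : perm_eq (rot p w) w by rewrite perm_rot.
have [t1 t1I t1E] := perm_labeling pw1.
have pw2 : perm_eq (rot p wZ ++ r) w by rewrite perm_cat2r perm_rot.
have [t2 t2I t2E] := perm_labeling pw2.
have rotw : rot p w = drop p wZ ++ r ++ take p wZ.
  rewrite /rot drop_cat take_cat swZ; case: ltnP => [_|qp]; first by rewrite catA.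
  have -> : p = q by apply/eqP; rewrite eqn_leq p_le.
  by rewrite subnn drop0 take0 cats0 drop_oversize ?take_oversize ?swZ.
have t12 : orientation_of t1 = orientation_of t2.
  apply: (filter_orientation Zcl t1I t2I).
    move=> x y xZ yZ xy; rewrite t1I t1I.
    rewrite -(index_filter_lt (P := mem Z)) //.
    by rewrite rotw /rot !filter_cat f3 cats0.
  rewrite rotw /rot !filter_cat f4.
  have : filter (predC (mem Z)) (take p wZ ++ drop p wZ) = [::] by rewrite cat_take_drop.
  by rewrite filter_cat; case: filter => //= ->; rewrite cats0.
have t1V : labeling_vertex t1 = iter p (@rotate N X) (labeling_vertex t).
  apply/val_inj/ffunP=> i; rewrite val_iter_rotate !ffunE.
  rewrite (t1E x0) nth_rot ?sw //; last first.
    by rewrite -sw size_cat swZ; lia.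
  by rewrite (tE x0) -(val_iter_ordS p (i : 'I_N)).
have t2V : labeling_vertex t2 = labeling_vertex t.
  have sm : size (map (@proj X) wZ) = q by rewrite size_map.
  have pm : map (@proj X) (rot p wZ) = map (@proj X) wZ.
    apply: (@eq_from_nth _ (proj x0)); first by rewrite map_rot size_rot.
    move=> i; rewrite map_rot size_rot sm => iq.
    rewrite nth_rot sm // -[i]/(val (Ordinal iq)).
    rewrite -(val_iter_ordS p (Ordinal iq)) !nth_wZ.
    by have /andP[_ /forallP/(_ (Ordinal iq))/eqP] := sZ_p.
  have pm2 : map (@proj X) (rot p wZ ++ r) = map (@proj X) w by rewrite map_cat pm -map_cat.
  apply/val_inj/ffunP=> i; rewrite !ffunE (t2E x0) (tE x0).
  have i1 : i < size w by rewrite sw.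
  have i2 : i < size (rot p wZ ++ r) by rewrite (perm_size pw2) sw.
  rewrite -(nth_map x0 (proj x0) (@proj X) i1) -(nth_map x0 (proj x0) (@proj X) i2).
  by rewrite pm2.
have word_in i : i < p -> word (labeling_vertex t) i \in [set proj x | x in Z].
  move=> ip; have iq : i < q by apply: leq_trans ip p_le.
  have iN : i < N by rewrite -sw size_cat swZ; apply: leq_trans iq (leq_addr _ _).
  rewrite word_labeling (modord_ord (Ordinal iN)) (tE x0) /= nth_cat swZ iq.
  rewrite -(nth_map _ (proj x0)) ?swZ // -[i]/(val (Ordinal iq)) nth_wZ.
  by apply: imset_f; exact: valP.
split.
  apply: connect_trans (_ : connect sedge (labeling_vertex t) _).
    rewrite -t2V; apply: connect_trans (same_orientation_connect t12).
    by rewrite t1V connect_rotate; exact: same_orientation_connect.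
  by apply: same_orientation_connect.
exists (fun v => cnt (word (labeling_vertex t)) v p); split.
- have st := same_orientation_shifted ta; have ts := same_orientation_shifted (esym ta).
  have := same_orientation_shifted t12; rewrite t2V t1V => tt.
  have tr := shifted_drop (F := word (labeling_vertex t)) (a := p).
  have {}tr := eq_shifted_r (fun k => esym (word_rotate p (labeling_vertex t) k)) tr.
  have pw f := @pword_word X n f.
  have h1 := shifted_trans (pw _) (pw _) st tr (fun=> erefl).
  have h2 := shifted_trans (pw _) (pw _) h1 tt (fun=> erefl).
  by apply: (shifted_trans (pw _) (pw _) h2 ts) => v /=; rewrite !addn0.
- move=> v vZ; rewrite /cnt big1 // => i _; case: eqP => // iv.
  by rewrite -iv word_in in vZ.
- exact: sum_cnt.
Qed.

End RotatePeriod.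

(** * Self-shifts supported on one component *)

Lemma card_induced (G : sgraph) (Z : {set G}) : #|induced Z| = #|Z|.
Proof. by rewrite card_sig; apply: eq_card. Qed.

Lemma mult_proj_gt0 (X : mgraph) (x : colift X) : 0 < mult (proj x).
Proof. by case: x => v [i lti]; apply: leq_ltn_trans lti. Qed.

Lemma ex_proj (X : mgraph) (v : X) : 0 < mult v -> exists x : colift X, proj x = v.
Proof. by move=> v0; exists (Tagged (fun v => 'I_(mult v)) (Ordinal v0)). Qed.

Section ComponentShifts.
Variables (X : mgraph) (n : nat).
Local Notation N := n.+1.
Variables (s : labeling N (colift X)) (Z : {set colift X}).
Local Notation F := (word (labeling_vertex s)).
Local Notation VZ := [set proj x | x in Z].
Hypothesis Zcl : edge_closed Z.
Hypothesis Zconn : {in Z &, forall x y, connect sedge x y}.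
Hypothesis Zfull : forall x y, x \in Z -> proj y = proj x -> y \in Z.

Let Fp : pword N mult F := pword_word _.

Lemma mem_proj_full x : (proj x \in VZ) = (x \in Z).
Proof.
apply/idP/idP=> [/imsetP[y yZ xy]|xZ]; first exact: Zfull yZ xy.
exact: imset_f.
Qed.

Lemma nocomm_component u v : 0 < mult u -> 0 < mult v -> nocomm u v ->
  (u \in VZ) = (v \in VZ).
Proof.
move=> /ex_proj[x <-] /ex_proj[y <-] xy; rewrite !mem_proj_full.
by apply: Zcl; rewrite colift_edgeE.
Qed.

(** Two noncommuting letters that occur are both in [VZ] or both outside, so [shifted] never
    compares a kept entry with an erased one. *)
Lemma shifted_restrict e : shifted F F e ->
  shifted F F (fun v => if v \in VZ then e v else 0).
Proof.
move=> Fe k l kl hk v uv; have cu := pword_gt0 k Fp.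
have [cv|] := posnP (mult v).
  rewrite !(cnt_eq0 _ Fp) // ifN //; apply/negP=> /imsetP[x _ vx].
  by have := mult_proj_gt0 x; rewrite -vx cv.
move=> cv; move: hk; rewrite -(nocomm_component cu cv uv); case: ifP => _ hk.
  exact: Fe.
by apply: (shifted_refl (F := F)) uv.
Qed.

Lemma shifted_rate_connect e x y : shifted F F e -> connect sedge x y ->
  e (proj x) * mult (proj y) = e (proj y) * mult (proj x).
Proof.
move=> Fe /connectP[p]; elim: p x => [|z p IHp] x; first by move=> _ ->.
case/andP=> exz pth lst; have xz : nocomm (proj x) (proj z) by rewrite -colift_edgeE.
have h1 := IHp _ pth lst; have h2 := shifted_rate Fp Fe (mult_proj_gt0 x) xz.
apply/eqP; rewrite -(eqn_pmul2r (mult_proj_gt0 z)); apply/eqP.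
by rewrite mulnAC h2 mulnAC h1 mulnAC.
Qed.

Lemma card_component : #|Z| = \sum_(v in VZ) mult v.
Proof.
rewrite -sum1_card (partition_big (@proj X) (mem VZ)) /=; last first.
  by move=> x xZ; exact: imset_f.
apply: eq_bigr => v /imsetP[y yZ vy]; rewrite -card_fiber -sum1_card.
apply: eq_bigl => x; rewrite !inE; case: eqP => xv; rewrite ?andbF ?andbT //.
by apply: Zfull yZ _; rewrite xv.
Qed.

(** Connectedness of [Z] spreads the proportionality to all its letters; a self-shift supported
    there is thus determined by its sum. *)
Lemma shifted_rate_component e u : shifted F F e -> u \in VZ ->
  e u * #|Z| = (\sum_(v in VZ) e v) * mult u.
Proof.
move=> Fe /imsetP[x xZ ->]; rewrite card_component big_distrr big_distrl /=.
apply: eq_bigr => _ /imsetP[y yZ ->].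
by apply: shifted_rate_connect => //; exact: Zconn.
Qed.

Definition self_shift E := exists e, [/\ shifted F F e,
  forall v, v \notin VZ -> e v = 0 & \sum_(v in VZ) e v = E].

Lemma self_shift_card : self_shift #|Z|.
Proof.
exists (fun v => if v \in VZ then mult v else 0); split.
- exact: shifted_restrict (shifted_period Fp).
- by move=> v /negbTE ->.
- by rewrite card_component; apply: eq_bigr => v ->.
Qed.

Lemma self_shift_gcd p E : 0 < p -> self_shift p -> self_shift E ->
  self_shift (gcdn p E).
Proof.
move=> p0 [e1 [Fe1 e1Z e1p]] [e2 [Fe2 e2Z e2E]].
have [x y xy _] := egcdnP E p0.
have Z0 u : u \in VZ -> 0 < #|Z|.
  by case/imsetP=> z zZ _; rewrite card_gt0; apply/set0Pn; exists z.
(* The Bezout combination stays nonnegative letter by letter: both vectors are proportional to the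
   multiplicities, and [x * p >= y * E]. *)
have le21 v : y * e2 v <= x * e1 v.
  have [vZ|vZ] := boolP (v \in VZ); last by rewrite e1Z // e2Z // muln0.
  rewrite -(leq_pmul2r (Z0 _ vZ)) -!mulnA !shifted_rate_component // e1p e2E.
  by rewrite !mulnA leq_mul2r xy leq_addr orbT.
exists (fun v => x * e1 v - y * e2 v); split.
- apply: (shiftedB Fp (@shiftedM _ _ _ _ Fp _ x Fe1) (@shiftedM _ _ _ _ Fp _ y Fe2)).
  by move=> v; rewrite subnKC.
- by move=> v vZ; rewrite e1Z // e2Z // !muln0.
- rewrite sumnB => [|v _]; last exact: le21.
  by rewrite -!big_distrr /= e1p e2E xy addKn.
Qed.


(** * From a self-shift of total [g] to a linear extension with period [g] *)

Section PeriodicExtension.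
Variables (m g : nat) (e : X -> nat).
Hypothesis g_gt0 : 0 < g.
Hypothesis cardZ : #|Z| = m * g.
Hypothesis Fe : shifted F F e.
Hypothesis eg : \sum_(v in VZ) e v = g.

Lemma mult_block v : v \in VZ -> mult v = m * e v.
Proof.
move=> vZ; have := shifted_rate_component Fe vZ; rewrite cardZ eg.
by move=> h; apply/eqP; rewrite -(eqn_pmul2l g_gt0) -h; lia.
Qed.

Lemma block_gt0 x : x \in Z -> 0 < e (proj x).
Proof.
move=> xZ; have := mult_proj_gt0 x.
by rewrite mult_block ?imset_f // muln_gt0 => /andP[].
Qed.

Definition rank (x : colift X) := cnt F (proj x) (lab_inv s x).

Lemma word_lab_inv x : F (lab_inv s x) = proj x.
Proof. by rewrite word_labeling modord_ord lab_invK. Qed.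

Lemma rank_lt x : rank x < mult (proj x).
Proof.
have [_ _ <-] := Fp; apply: ltn_cnt => //; exact: word_lab_inv.
Qed.

Lemma rank_inj x y : proj x = proj y -> rank x = rank y -> x = y.
Proof.
move=> xy rxy; apply: (lab_inv_inj (s := s)); apply: val_inj.
apply: (@cnt_inj _ F (proj x)); rewrite ?word_lab_inv //.
by move: rxy; rewrite /rank xy.
Qed.

(* The position in s of the token of the first block corresponding to x. *)
Definition first_pos (x : colift X) : nat :=
  odflt ord0 [pick i : 'I_N | (F i == proj x) &&
    (cnt F (proj x) i == rank x %% e (proj x))].

Lemma first_posP x : x \in Z -> F (first_pos x) = proj x /\
  cnt F (proj x) (first_pos x) = rank x %% e (proj x).
Proof.
move=> xZ; rewrite /first_pos; case: pickP => /= [i /andP[/eqP ? /eqP ?] //|no].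
have [k Fk hk] := ex_cnt (rank x %% e (proj x)) Fp (mult_proj_gt0 x).
have kN : k < N.
  rewrite -(ltn_cntE _ Fk) hk; have [_ _ ->] := Fp.
  exact: leq_ltn_trans (leq_mod _ _) (rank_lt x).
by have := no (Ordinal kN); rewrite /= Fk hk !eqxx.
Qed.

(** The number of tokens of the first block, which has [e u] copies of each letter [u], standing
    before position [k]. *)
Definition first_index k := \sum_(u in VZ) minn (cnt F u k) (e u).

Lemma first_index_lt x : x \in Z -> first_index (first_pos x) < g.
Proof.
move=> xZ; have [_ hx] := first_posP xZ; have vZ := imset_f (@proj X) xZ.
rewrite -eg /first_index !(bigD1 (P := mem VZ) (proj x)) //= -addSn leq_add //.
  by rewrite hx gtn_min ltn_mod block_gt0.
by apply: leq_sum => u _; exact: geq_minr.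
Qed.

Lemma first_index_mono x k : x \in Z -> first_pos x < k ->
  first_index (first_pos x) < first_index k.
Proof.
move=> xZ lt_xk; have [Fx hx] := first_posP xZ; have vZ := imset_f (@proj X) xZ.
have := ltn_cnt Fx lt_xk; have ltr := ltn_pmod (rank x) (block_gt0 xZ).
rewrite /first_index !(bigD1 (P := mem VZ) (proj x)) //= hx => ltk.
rewrite -addSn; apply: leq_add; first by lia.
by apply: leq_sum => u _; have := leq_cnt F u (ltnW lt_xk); lia.
Qed.

Lemma first_index_inj x y : x \in Z -> y \in Z ->
  first_index (first_pos x) = first_index (first_pos y) -> first_pos x = first_pos y.
Proof.
move=> xZ yZ xy; have := first_index_mono (k := first_pos y) xZ.
by have := first_index_mono (k := first_pos x) yZ; rewrite xy ltnn; lia.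
Qed.

Definition block (x : colift X) := rank x %/ e (proj x).

Definition new_pos (x : colift X) := block x * g + first_index (first_pos x).

Lemma new_pos_lt x : x \in Z -> new_pos x < #|Z|.
Proof.
move=> xZ; rewrite cardZ /new_pos; have := first_index_lt xZ.
suff : block x < m by nia.
rewrite ltn_divLR ?block_gt0 // -mult_block ?imset_f //; exact: rank_lt.
Qed.

Lemma new_pos_mod x y : x \in Z -> y \in Z -> new_pos x = new_pos y %[mod g] ->
  first_pos x = first_pos y.
Proof.
move=> xZ yZ; rewrite /new_pos !modnMDl !modn_small ?first_index_lt //.
exact: first_index_inj.
Qed.

Lemma new_pos_inj : {in Z &, injective new_pos}.
Proof.
move=> x y xZ yZ xy; have f_xy := new_pos_mod xZ yZ (congr1 (modn^~ g) xy).
have [Fx hx] := first_posP xZ; have [Fy hy] := first_posP yZ.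
have p_xy : proj x = proj y by rewrite -Fx -Fy f_xy.
apply: (rank_inj p_xy); rewrite (divn_eq (rank x) (e (proj x))).
rewrite (divn_eq (rank y) (e (proj y))) -hx -hy f_xy -p_xy; congr (_ * _ + _).
move: xy; rewrite /new_pos f_xy => /addIn/eqP.
by rewrite eqn_pmul2r // /block -p_xy => /eqP.
Qed.

Lemma new_pos_homo x y : x \in Z -> y \in Z -> nocomm (proj x) (proj y) ->
  lab_inv s x < lab_inv s y -> new_pos x < new_pos y.
Proof.
move=> xZ yZ xy lt_xy; have [Fx hx] := first_posP xZ; have [Fy hy] := first_posP yZ.
have bE z : z \in Z -> rank z = block z * e (proj z) + rank z %% e (proj z).
  by move=> _; exact: divn_eq.
have ltm z : z \in Z -> rank z %% e (proj z) < e (proj z).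
  by move=> zZ; rewrite ltn_mod block_gt0.
rewrite /new_pos; case: (ltngtP (block x) (block y)) => [lt_b|lt_b|eq_b].
- by have := first_index_lt xZ; have := first_index_lt yZ; nia.
(* Impossible case: after skipping [block y] plus one blocks, [y] has been skipped but [x] has not,
   so [shifted_block] puts [y] before [x]. *)
- have := shifted_block Fp (shiftedM Fp (x := (block y).+1) Fe) xy
    (word_lab_inv x) (word_lab_inv y).
  rewrite -/(rank x) -/(rank y) (bE x) // (bE y) // => h.
  have := ltm y yZ; suff : lab_inv s y < lab_inv s x by lia.
  by apply: h; [nia|have := ltm y yZ; nia].
- rewrite eq_b ltn_add2l; apply: first_index_mono => //.
  (* Removing the common number of full blocks carries [x] to its counterpart in the first block;
     counting the copies of [proj y] before each shows that the counterparts keep their order. *)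
  have h := shiftedM Fp (x := block x) Fe.
  have := h (lab_inv s x) (first_pos x); rewrite word_lab_inv Fx hx -/(rank x).
  rewrite {1}(bE x) // addnC => /(_ erefl erefl _ xy) cx.
  have := leq_cnt F (proj y) (ltnW lt_xy); rewrite cx -/(rank y) (bE y) // eq_b.
  rewrite addnC leq_add2l -hy => le_xy.
  have := ltn_cntE (first_pos x) Fy; have nxy : first_pos x != first_pos y.
    by apply: contraTneq xy => e_xy; rewrite /nocomm -Fx -Fy e_xy eqxx.
  by lia.
Qed.

Lemma ex_periodic_extension : exists2 sZ : labeling #|induced Z| (induced Z),
  linear_extension (restrict (orientation_of s) Z) sZ
  & periodic (fun x : induced Z => proj (val x)) sZ g.
Proof.
have lt_pos (x : induced Z) : new_pos (val x) < #|induced Z|.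
  by rewrite card_induced; apply: new_pos_lt; exact: valP.
have [|sZ sZI] := @ex_labeling_inv _ (induced Z) (fun x => Ordinal (lt_pos x)) _ erefl.
  by move=> x y [] /new_pos_inj xy; apply: val_inj; apply: xy; exact: valP.
exists sZ.
  apply/eqP/acyc_ext => x y.
  have -> : arc (restrict (orientation_of s) Z) x y =
    arc (orientation_of s) (val x) (val y) by rewrite /arc /= inE.
  rewrite !arc_orientation_of !sZI.
  have -> : @sedge (induced Z) x y = sedge (val x) (val y) by [].
  case exy: (sedge (val x) (val y)) => //=.
  have nxy : nocomm (proj (val x)) (proj (val y)) by rewrite -colift_edgeE.
  have h1 := new_pos_homo (valP x) (valP y) nxy.
  have := new_pos_homo (valP y) (valP x); rewrite nocomm_sym => /(_ nxy) h2.
  case: (ltngtP (lab_inv s (val x)) (lab_inv s (val y))) => [/h1|/h2/ltnW|] //=.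
    by move=> h; apply/negbTE; rewrite -leqNgt.
  by move=> /val_inj/lab_inv_inj/val_inj xy; move: nxy; rewrite xy /nocomm eqxx.
rewrite /periodic g_gt0; apply/forallP=> i; apply/eqP.
set j := iter _ _ i; have xZ := valP (sZ j); have yZ := valP (sZ i).
have [Fx _] := first_posP xZ; have [Fy _] := first_posP yZ.
(* Positions [g] apart, also across the end since [g] divides the size of [Z], have the same
   counterpart in the first block and hence the same letter. *)
rewrite -Fx -Fy (new_pos_mod xZ yZ) //.
have pE k : new_pos (val (sZ k)) = k by have := congr1 val (sZI (sZ k)); rewrite labK.
rewrite !pE [X in X %% _](val_iter_ordS g i) modn_dvdm ?modnDr //.
by rewrite card_induced cardZ dvdn_mull.
Qed.

End PeriodicExtension.
End ComponentShifts.

(** * Periods, delta, and the rotations fixing a component *)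

Section PeriodTheory.
Variables (G : sgraph) (P : eqType) (p : G -> P).

Lemma label_periodP (q : nat) (s : labeling q G) : periodic p s (label_period p s).
Proof. by rewrite /label_period; case: ex_minnP. Qed.

Lemma label_period_min (q t : nat) (s : labeling q G) :
  periodic p s t -> label_period p s <= t.
Proof. by rewrite /label_period; case: ex_minnP => m _; apply. Qed.

Lemma label_period_le (q : nat) (s : labeling q G) : 0 < q -> label_period p s <= q.
Proof.
move=> q0; apply: label_period_min; rewrite /periodic q0; apply/forallP=> i.
apply/eqP; congr (p (s _)); apply: val_inj.
by rewrite [LHS]val_iter_ordS modnDr modn_small.
Qed.

Lemma orientation_periodP (a : acyc G) : exists2 s : labeling #|G| G,
  linear_extension a s & label_period p s = orientation_period p a.
Proof.
rewrite /orientation_period; case: ex_minnP => m /existsP[s /andP[sa /eqP sm]] _.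
by exists s.
Qed.

Lemma orientation_period_min (a : acyc G) (s : labeling #|G| G) :
  linear_extension a s -> orientation_period p a <= label_period p s.
Proof.
move=> sa; rewrite /orientation_period; case: ex_minnP => m _; apply.
by apply/existsP; exists s; rewrite sa eqxx.
Qed.

Lemma orientation_period_gt0 (a : acyc G) : 0 < orientation_period p a.
Proof. by have [s _ <-] := orientation_periodP a; have /andP[] := label_periodP s. Qed.

End PeriodTheory.

Section Stabilizer.
Variables (X : mgraph) (n : nat).
Local Notation N := n.+1.
Variable s : labeling N (colift X).
Local Notation f0 := (labeling_vertex s).
Local Notation F := (word f0).
Local Notation a := (orientation_of s).
Local Notation rot k := (iter k (@rotate N X)).

Definition period_on (Z : {set colift X}) :=
  orientation_period (fun x : induced Z => proj (val x)) (restrict a Z).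

Lemma componentsP (Z : {set colift X}) : Z \in components (colift X) ->
  [/\ edge_closed Z, {in Z &, forall x y, connect sedge x y} & 0 < #|Z|].
Proof.
case/imsetP=> x _ ->; split; first exact: component_closed.
  move=> y z; rewrite !in_component => xy; apply: connect_trans.
  by rewrite sedge_connect_sym.
by rewrite card_gt0; apply/set0Pn; exists x; rewrite in_component.
Qed.

Lemma component_mem (Z : {set colift X}) x :
  Z \in components (colift X) -> x \in Z -> component x = Z.
Proof.
case/imsetP=> y _ ->; rewrite in_component => xy.
by apply/esym/eq_component.
Qed.

Lemma period_on_rotate Z : Z \in components (colift X) ->
  connect sedge (rot (period_on Z) f0) f0 /\ self_shift s Z (period_on Z).
Proof.
move=> /componentsP[Zcl _ Z0].
have [sZ sZa sZp] := orientation_periodP (fun x : induced Z => proj (val x)) (restrict a Z).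
have := rotate_period_connect Zcl sZa (label_periodP _ sZ).
rewrite label_period_le ?card_induced // sZp => /(_ isT) [h1 [e he]].
by split=> //; exists e.
Qed.

(** Including [#|Z|] in the gcd makes the blocks tile [Z]. The extension built from [g] forces
    [p <= g], while [g] divides [p]. *)
Lemma period_on_dvd Z E : Z \in components (colift X) ->
  (forall x y, x \in Z -> proj y = proj x -> y \in Z) ->
  self_shift s Z E -> period_on Z %| E.
Proof.
move=> ZC Zfull shE; have [Zcl Zconn Z0] := componentsP ZC.
have [_ shp] := period_on_rotate ZC; set p := period_on Z in shp *.
have p0 : 0 < p by exact: orientation_period_gt0.
pose g := gcdn (gcdn p #|Z|) E.
have g0 : 0 < g by rewrite !gcdn_gt0 p0.
have shg : self_shift s Z g.
  apply: self_shift_gcd => //; first by rewrite gcdn_gt0 p0.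
  by apply: self_shift_gcd => //; exact: self_shift_card.
have gp : g %| p by apply: dvdn_trans (dvdn_gcdl _ _) (dvdn_gcdl _ _).
have gZ : g %| #|Z| by apply: dvdn_trans (dvdn_gcdl _ _) (dvdn_gcdr _ _).
have [m cZ] := dvdnP gZ; have [e [Fe _ eg]] := shg.
have [sZ sZa sZg] := ex_periodic_extension Zconn Zfull g0 cZ Fe eg.
suff -> : p = g by exact: dvdn_gcdr.
apply/eqP; rewrite eqn_leq [g <= p]dvdn_leq // andbT.
apply: leq_trans (label_period_min sZg).
exact: orientation_period_min.
Qed.

(** Tokens of one letter have the same neighbours in the colift. If [x] has such a twin outside its
    component, it has no neighbour at all and [Z] is a single point. *)
Lemma period_on_not_full Z x y : Z \in components (colift X) ->
  x \in Z -> proj y = proj x -> y \notin Z -> period_on Z = 1.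
Proof.
move=> ZC xZ yx yZ; have [Zcl Zconn Z0] := componentsP ZC.
have Zx : Z = [set x].
  apply/setP=> z; rewrite inE; apply/idP/eqP=> [zZ|->//].
  have /connectP[[|w p] /=] := Zconn _ _ xZ zZ; first by move=> _ ->.
  case/andP=> exw _ _; case/negP: yZ.
  have xw : sedge x w by [].
  rewrite (Zcl y w) -?(Zcl _ _ xw) //.
  by rewrite colift_edgeE yx -colift_edgeE.
apply/eqP; rewrite eqn_leq orientation_period_gt0 andbT.
have [sZ sZa] := orientation_periodP (fun x : induced Z => proj (val x)) (restrict a Z).
rewrite /period_on => <-; have q1 : #|induced Z| = 1 by rewrite card_induced Zx cards1.
by rewrite -[X in _ <= X]q1; apply: label_period_le; rewrite q1.
Qed.

(** The rotations that fix the component of [f0] include each period and are closed under multiples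
    and, by Bezout, under gcd. *)
Lemma delta_rotate : connect sedge (rot (delta a) f0) f0.
Proof.
pose Q k := connect sedge (rot k f0) f0.
have QM x k : Q k -> Q (x * k).
  move=> Qk; elim: x => [|x IHx]; first exact: connect0.
  rewrite mulSn /Q addnC iterD; apply: connect_trans IHx.
  by rewrite connect_rotate.
rewrite /delta; apply: (big_ind Q); first exact: connect0; last first.
  by move=> Z /period_on_rotate[].
move=> k l Qk Ql; have [->|k0] := posnP k; first by rewrite gcd0n.
have [x y xy _] := egcdnP l k0.
have := QM x k Qk; rewrite xy /Q addnC iterD; apply: connect_trans.
by rewrite connect_rotate sedge_connect_sym; exact: QM.
Qed.

(** Assigns each letter to one component, so that a sum over letters splits by components. If the
    fiber is spread over several, the pick is arbitrary but harmless: these have period 1 by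
    [period_on_not_full]. *)
Definition token_component (v : X) : {set colift X} :=
  odflt set0 (omap (@component (colift X)) [pick x | proj x == v]).

Lemma token_componentP v : 0 < mult v ->
  exists2 x, proj x = v & token_component v = component x.
Proof.
move=> /ex_proj[y yv]; rewrite /token_component; case: pickP => [x /eqP xv|no].
  by exists x.
by have := no y; rewrite yv eqxx.
Qed.

Lemma delta_dvd_shift e : shifted F F e -> delta a %| \sum_(v : X | 0 < mult v) e v.
Proof.
move=> Fe.
rewrite (partition_big token_component (mem (components (colift X)))) /=; last first.
  by move=> v /token_componentP[x _ ->]; exact: imset_f.
apply: dvdn_sum => Z ZC; apply: (dvdn_trans (n := period_on Z)).
  exact: (biggcdn_inf Z ZC (dvdnn _)).
have [Zcl Zconn Z0] := componentsP ZC.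
have [full|] := boolP [forall x : colift X in Z, forall y : colift X,
    (proj y == proj x) ==> (y \in Z)].
  have Zfull x y : x \in Z -> proj y = proj x -> y \in Z.
    move=> xZ /eqP yx; have /forallP/(_ x)/implyP/(_ xZ)/forallP/(_ y) := full.
    by rewrite yx.
  apply: period_on_dvd => //; exists (fun v => if v \in [set proj x | x in Z] then e v else 0).
  split; first exact: shifted_restrict.
    by move=> v /negbTE ->.
  apply: eq_big => [v|v ->] //; apply/idP/andP.
    case/imsetP=> z zZ ->; split; first exact: mult_proj_gt0.
    have [x xz ->] := token_componentP (mult_proj_gt0 z).
    by apply/eqP/component_mem => //; apply: Zfull xz.
  case=> v0 /eqP vZ; have [x xv vE] := token_componentP v0.
  by rewrite -xv; apply: imset_f; rewrite -vZ vE in_component.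
case/forallPn=> x; rewrite negb_imply => /andP[xZ /forallPn[y]].
rewrite negb_imply => /andP[/eqP yx yZ].
by rewrite (period_on_not_full ZC xZ yx yZ) dvd1n.
Qed.

End Stabilizer.

Section StabilizerFS.
Variables (X : mgraph) (n : nat).
Local Notation N := n.+1.
Local Notation rot k := (iter k (@rotate N X)).
Implicit Types (f g h : FS N X).
Hypothesis cX : #|colift X| = N.

Lemma shifted_rotate f k : exists2 e, shifted (word f) (word (rot k f)) e
  & \sum_(v : X | 0 < mult v) e v = k.
Proof.
exists (fun v => cnt (word f) v k).
  exact: eq_shifted_r (fun i => esym (word_rotate k f i)) (shifted_drop (a := k)).
by apply: sum_cnt => i _; exact: (pword_gt0 i (pword_word f)).
Qed.

Lemma shifted_word_trans f g h k l :
  (exists2 e, shifted (word f) (word g) e & \sum_(v : X | 0 < mult v) e v = k) ->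
  (exists2 e, shifted (word g) (word h) e & \sum_(v : X | 0 < mult v) e v = l) ->
  exists2 e, shifted (word f) (word h) e & \sum_(v : X | 0 < mult v) e v = k + l.
Proof.
move=> [e fg <-] [e' gh <-]; exists (fun v => e v + e' v); last exact: big_split.
exact: (shifted_trans (pword_word _) (pword_word _) fg gh).
Qed.

(** Rotate by [k], swap, then rotate by [k * N - k]: the swap skips nothing, so whole turns
    remain. *)
Lemma shifted_edge f g : sedge f g -> exists k, exists2 e,
  shifted (word f) (word g) e & \sum_(v : X | 0 < mult v) e v = k * N.
Proof.
move=> /(FS_edge_rotate cX)[k [t [t' [tE t'E tt']]]]; exists k.
have h1 := shifted_rotate f k.
have h2 : exists2 e, shifted (word (rot k f)) (word (rot k g)) e
    & \sum_(v : X | 0 < mult v) e v = 0.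
  exists (fun=> 0); last exact: big1.
  by rewrite -tE -t'E; exact: same_orientation_shifted.
have kN : k <= k * N by rewrite leq_pmulr.
have := shifted_rotate (rot k g) (k * N - k); rewrite -iterD subnK // rotate_period => h3.
by have := shifted_word_trans (shifted_word_trans h1 h2) h3; rewrite addn0 subnKC.
Qed.

Lemma shifted_connect f g : connect sedge f g -> exists k, exists2 e,
  shifted (word f) (word g) e & \sum_(v : X | 0 < mult v) e v = k * N.
Proof.
case/connectP=> p; elim: p f => [|h p IHp] f.
  by move=> _ ->; exists 0, (fun=> 0); [exact: shifted_refl|exact: big1].
case/andP=> fh pth lst; have [k h1] := shifted_edge fh; have [l h2] := IHp _ pth lst.
by exists (k + l); rewrite mulnDl; exact: shifted_word_trans h1 h2.
Qed.

Lemma delta_dvd (s : labeling N (colift X)) k :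
  connect sedge (labeling_vertex s) (rot k (labeling_vertex s)) ->
  delta (orientation_of s) %| k.
Proof.
set f := labeling_vertex s => fk.
have stab k' : connect sedge f (rot k' f) -> exists l,
    delta (orientation_of s) %| l * N + (k' * N - k').
  move/shifted_connect=> [l h1]; exists l.
  have k'N : k' <= k' * N by rewrite leq_pmulr.
  have := shifted_rotate (rot k' f) (k' * N - k'); rewrite -iterD subnK // rotate_period => h2.
  by have [e fe <-] := shifted_word_trans h1 h2; exact: delta_dvd_shift.
(* A full turn is itself a self-shift, of total [N]; this allows multiples of [N] to be
   discarded. *)
have dN : delta (orientation_of s) %| N.
  have [e fe] := shifted_rotate f N.
  have := rotate_period 1 f; rewrite mul1n => fN; rewrite fN in fe.
  by move=> eN; rewrite -[X in _ %| X]eN; exact: delta_dvd_shift.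
have [l] := stab k fk; rewrite dvdn_addr ?dvdn_mull // => dk.
have := dvdn_mull k dN.
have kN : k <= k * N by rewrite leq_pmulr.
by rewrite -{1}(subnK kN) dvdn_addr.
Qed.

Lemma delta_gt0 (s : labeling N (colift X)) : 0 < delta (orientation_of s).
Proof.
have : delta (orientation_of s) %| N.
  by apply: delta_dvd; have := rotate_period 1 (labeling_vertex s); rewrite mul1n => ->.
by move/dvdn_gt0; apply.
Qed.

End StabilizerFS.

(** * Rotated components and the decomposition *)

Lemma graph_iso_imset (G : sgraph) (h : G -> G) (A : {set G}) :
  injective h -> {mono h : x y / sedge x y} ->
  graph_iso (induced A) (induced (h @: A)).
Proof.
move=> h_inj h_mono.
pose k (x : induced A) : induced (h @: A) := Sub (h (val x)) (imset_f h (valP x)).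
exists k => [|x y]; last exact: h_mono.
apply: inj_card_bij; last by rewrite !card_induced card_imset.
by move=> x y /(congr1 val) /= /h_inj/val_inj.
Qed.

Lemma simeq_class_eq (X : mgraph) (C : {set acyc (colift X)}) a :
  C \in simeq_classes X -> a \in C -> C = [set b | simeq a b].
Proof.
case/imsetP=> b _ ->; rewrite inE => ba; apply/setP=> c; rewrite !inE.
apply/idP/idP; last exact: simeq_trans ba.
by apply: simeq_trans; rewrite simeq_sym.
Qed.

Section RotatedComponents.
Variables (X : mgraph) (n : nat).
Local Notation N := n.+1.
Local Notation rot k := (iter k (@rotate N X)).
Implicit Types (f g : FS N X) (s : labeling N (colift X)).

Lemma rotate_inj k : injective (rot k).
Proof. by elim: k => [|k IHk] f g //= /(bij_inj (rotate_bij _ _))/IHk. Qed.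

Lemma sedge_iter_rotate k : {mono rot k : f g / sedge f g}.
Proof. by elim: k => [|k IHk] f g //; rewrite !iterS sedge_rotate. Qed.

Lemma imset_rotate_component k f : rot k @: component f = component (rot k f).
Proof.
apply/setP=> g; rewrite in_component; apply/imsetP/idP=> [[h]|fg].
  by rewrite in_component => fh ->; rewrite connect_rotate.
have kN : k <= k * N by rewrite leq_pmulr.
have gE : g = rot k (rot (k * N - k) g) by rewrite -iterD subnKC ?rotate_period.
exists (rot (k * N - k) g) => //; rewrite in_component.
by rewrite -(connect_rotate k) -gE.
Qed.

Lemma stabilizer_rot_connect k f g :
  rot_connect f g -> connect sedge g (rot k g) -> connect sedge f (rot k f).
Proof.
case=> l fg gk; apply: (connect_trans fg).
apply: connect_trans (_ : connect sedge _ (rot l (rot k g))) _.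
  by rewrite connect_rotate.
by rewrite -iterD addnC iterD connect_rotate sedge_connect_sym.
Qed.

(** Delta is evaluated at [a], while [s] may extend another orientation of the class. A linear
    extension [t] of [a] is reached from [s] by a rotation and a path, and rotations commute, so
    both components are fixed by the same rotations. *)
Lemma rotate_stabilizer a s : simeq a (orientation_of s) ->
  0 < delta a /\ forall k, connect sedge (labeling_vertex s) (rot k (labeling_vertex s))
    = (delta a %| k).
Proof.
move=> sa; have cX := card_labeling s.
have [t ta] := ex_linear_extensionN cX a.
have ts := simeq_lv_rel cX sa ta (eqxx _).
have st := rot_connect_sym ts.
rewrite -(eqP ta); split=> [|k]; first exact: (delta_gt0 cX).
apply/idP/idP=> [sk|/dvdnP[x ->]].
  by apply: (delta_dvd cX); exact: stabilizer_rot_connect sk.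
apply: (stabilizer_rot_connect st).
elim: x => [|x IHx]; first exact: connect0.
rewrite mulSn iterD; set l := delta _.
apply: connect_trans (_ : connect sedge _ (rot l (labeling_vertex t))) _.
  by rewrite sedge_connect_sym delta_rotate.
by rewrite connect_rotate.
Qed.

End RotatedComponents.

Theorem theorem5p8 (X : mgraph) (n : nat) (n_gt0 : 0 < n)
    (X_n : total_mult X = n)
    (alpha : {set acyc (colift X)} -> acyc (colift X))
    (alphaP : forall C, C \in simeq_classes X -> alpha C \in C)
    (sigma : {set acyc (colift X)} -> labeling n (colift X))
    (sigmaP : forall C, C \in simeq_classes X ->
      exists2 b : acyc (colift X), b \in C & linear_extension b (sigma C)) :
  let d (C : {set acyc (colift X)}) : nat := delta (alpha C) in
  let H (C : {set acyc (colift X)}) : {set FS n X} :=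
    component (labeling_vertex (sigma C)) in
  let K (C : {set acyc (colift X)}) (k : nat) : {set FS n X} :=
    iter k (@rotate n X) @: H C in
  (forall C, C \in simeq_classes X ->
    [/\ forall k, k < d C -> K C k \in components (FS n X),
        forall j k, j < d C -> k < d C -> j <> k -> K C j <> K C k
      & forall j k, j < d C -> k < d C ->
          graph_iso (induced (K C j)) (induced (K C k))])
  /\ is_direct_sum
       (fun Ck : {set acyc (colift X)} * nat =>
          (Ck.1 \in simeq_classes X) && (Ck.2 < d Ck.1))
       (fun Ck => K Ck.1 Ck.2).
Proof.
case: n n_gt0 X_n sigma sigmaP => // n _ _ sigma sigmaP d H K.
pose f C := labeling_vertex (sigma C).
have KE C k : K C k = component (iter k (@rotate n.+1 X) (f C)).
  exact: imset_rotate_component.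
have sigmaC C : C \in simeq_classes X -> orientation_of (sigma C) \in C.
  by move=> /sigmaP[b bC /eqP ->].
have stab C : C \in simeq_classes X -> 0 < d C /\
    forall k, connect sedge (f C) (iter k (@rotate n.+1 X) (f C)) = (d C %| k).
  move=> CC; apply: rotate_stabilizer.
  have /setP/(_ (orientation_of (sigma C))) := simeq_class_eq CC (alphaP C CC).
  by rewrite sigmaC // inE => <-.
have distinct C j k : C \in simeq_classes X -> j < d C -> k < d C ->
    connect sedge (iter j (@rotate n.+1 X) (f C)) (iter k (@rotate n.+1 X) (f C)) ->
    j = k.
  move=> CC; wlog jk : j k / j <= k.
    move=> wl jd kd jk; case/orP: (leq_total j k) => le_jk; first exact: wl.
    by apply/esym/wl => //; rewrite sedge_connect_sym.
  move=> jd kd; rewrite -(subnKC jk) iterD connect_rotate; have [_ ->] := stab C CC.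
  by have [->|kj0 /(dvdn_leq kj0)] := posnP (k - j); lia.
split=> [C CC|].
  split=> [k _|j k jd kd njk|j k jd kd].
  - by rewrite KE; exact: imset_f.
  - rewrite !KE => Kjk; apply: njk; apply: (distinct C) => //.
    by rewrite -in_component Kjk in_component.
  have jN : j <= j * n.+1 by rewrite leq_pmulr.
  (* Rotate back by [j], then forward by [k]. *)
  have -> : K C k = iter (k + (j * n.+1 - j)) (@rotate n.+1 X) @: K C j.
    by rewrite !KE imset_rotate_component -iterD -addnA subnK // iterD rotate_period.
  by apply: graph_iso_imset; [exact: rotate_inj|exact: sedge_iter_rotate].
split=> [[C j] [C' k] /andP[/= CC jd] /andP[/= C'C kd] neq|x|[C k] _ x y xy].
- change (is_true [disjoint K C j & K C' k]); rewrite !KE.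
  rewrite -setI_eq0; apply/eqP/setP=> g; rewrite in_setI !in_component in_set0.
  apply/negP=> /andP[jg]; rewrite sedge_connect_sym => gk.
  have jk := connect_trans jg gk.
  have CC' : C = C'.
    rewrite (simeq_class_eq CC (sigmaC _ CC)) (simeq_class_eq C'C (sigmaC _ C'C)).
    have [l fl] : rot_connect (f C) (f C').
      apply: rot_connect_trans (_ : rot_connect (iter j (@rotate n.+1 X) (f C)) _).
        by apply: rot_connect_sym; exists j; exact: connect0.
      by exists k.
    have ss := connect_simeq fl; apply/setP=> b; rewrite !inE.
    apply/idP/idP; last exact: simeq_trans ss.
    by apply: simeq_trans; rewrite simeq_sym.
  subst C'; case/eqP: neq; congr (_, _); exact: (distinct C).
(* Any labeling shows that the colift has [n.+1] vertices; [set0] is an arbitrary argument. *)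
- have [t tx] := ex_labeling_vertex x (card_labeling (sigma set0)).
  pose C := [set b | simeq (orientation_of t) b].
  have CC : C \in simeq_classes X by exact: imset_f.
  have := sigmaC C CC; rewrite {2}/C inE => ts.
  have [k] := simeq_lv_rel (card_labeling t) ts (eqxx _) (eqxx _).
  rewrite tx -/(f C) => xk; have [d0 stabC] := stab C CC.
  (* Rotations by multiples of [d C] fix the component, so only the remainder of [k] matters. *)
  exists (C, k %% d C); first by rewrite /= CC ltn_mod.
  rewrite [K _ _]KE in_component sedge_connect_sym; apply: connect_trans xk _.
  rewrite {1}(divn_eq k (d C)) addnC iterD connect_rotate sedge_connect_sym.
  by rewrite stabC dvdn_mull.
- by rewrite [K _ _]KE; exact: component_closed.
Qed.
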